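(* For any $\mu>0$, $\mathcal L(\cdot,\mu)$ is gradient dominated over its $\alpha$-sublevel set $\mathcal S_\alpha=\{X\in\mathcal S:\mathcal L(X,\mu)\le\alpha\}$, i.e. $$\mathcal L(X,\mu)-\mathcal L^*(\mu)\le\lambda_\alpha\cdot\operatorname{tr}\{\nabla_X\mathcal L(X,\mu)^\top\nabla_X\mathcal L(X,\mu)\},\qquad\forall X\in\mathcal S_\alpha,$$ where $\lambda_\alpha=\|\Phi^*\|/(4\,\underline\sigma(R)\,\sigma_\alpha^2)>0$ is a constant over $\mathcal S_\alpha$ and $\sigma_\alpha=\min_{X\in\mathcal S_\alpha}\underline\sigma(\Phi_X)>0$.
   Context: Setting. $x_{t+1}=Ax_t+Bu_t+w_t$ with $x_t\in\mathbb R^n$, $u_t\in\mathbb R^m$; $\{w_t\}$ is an i.i.d. sequence with finite fourth moments, mean $\bar w=\mathbb E[w_t]$ and covariance $W=\mathbb E[(w_t-\bar w)(w_t-\bar w)^\top]>0$ (positive definite). $Q$ is positive semi-definite, $R$ is positive definite, $(A,B)$ is controllable and $(A,Q^{1/2})$ is observable. Let $M_3=\mathbb E[(w_t-\bar w)(w_t-\bar w)^\top Q(w_t-\bar w)]$ and let $\bar\rho\in\mathbb R$ be a given constant. A policy is $X=[K,l]$ with $K\in\mathbb R^{m\times n}$, $l\in\mathbb R^m$, meaning $u_t=-Kx_t+l$. $\mathcal S=\{[K,l]:\rho(A-BK)<1\}$ ($\rho(\cdot)$ = spectral radius). For $\mu\ge0$ let $Q_\mu=Q+4\mu QWQ$,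 $S=2\mu QM_3\in\mathbb R^n$, $c_\mu(x,u)=x^\top Q_\mu x+2x^\top S+u^\top Ru-\mu\bar\rho$. For $X\in\mathcal S$ the Lagrangian is $\mathcal L(X,\mu)=\lim_{T\to\infty}\tfrac1T\mathbb E[\sum_{t=0}^{T-1}c_\mu(x_t,u_t)]$ with $u_t=-Kx_t+l$; $\mathcal L^*(\mu)=\min_{X\in\mathcal S}\mathcal L(X,\mu)$. For $X\in\mathcal S$ the stationary mean and covariance of the state satisfy $\bar x_X=(A-BK)\bar x_X+Bl+\bar w$ and $\Sigma_K=W+(A-BK)\Sigma_K(A-BK)^\top$, and $$\Phi_X=\begin{bmatrix}\Sigma_K+\bar x_X\bar x_X^\top&-\bar x_X\\-\bar x_X^\top&1\end{bmatrix}>0.$$ $\Phi^*=\Phi_{X^*(\mu)}$, where $X^*(\mu)=[K_\mu,l_\mu]\in\mathcal S$ is the unique critical point of $\mathcal L(\cdot,\mu)$ in $\mathcal S$, given by $K_\mu=(R+B^\top P_{K_\mu}B)^{-1}B^\top P_{K_\mu}A$ and $l_\mu=-(R+B^\top P_{K_\mu}B)^{-1}B^\top V^\top(P_{K_\mu}\bar w+S)$ with $V=(I-(A-BK_\mu))^{-1}$ and $P_K\ge0$ solving $P_K=Q_\mu+K^\top RK+(A-BK)^\top P_K(A-BK)$. $\underline\sigma(\cdot)$ is the minimum eigenvalue of a positive definite matrix and $\|\cdot\|$ the spectral norm. *)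

(* Defs.v *)
From HB Require Import structures.
From mathcomp Require Import all_boot all_order all_algebra.
From mathcomp Require Import finmap complex.
From mathcomp Require Import all_classical all_reals all_analysis.

Set Implicit Arguments.
Unset Strict Implicit.
Unset Printing Implicit Defensive.

Import Order.TTheory GRing.Theory Num.Theory.
Import numFieldNormedType.Exports.

Local Open Scope classical_set_scope.
Local Open Scope ring_scope.

Section matrices.
Context {R : realType}.

Definition inner n (x y : 'cV[R]_n) : R := (x^T *m y) 0 0.
Definition norm2 n (x : 'cV[R]_n) : R := Num.sqrt (inner x x).
Definition qform n (M : 'M[R]_n) (x : 'cV[R]_n) : R := inner x (M *m x).

Definition psd n (M : 'M[R]_n) : Prop :=
  M^T = M /\ forall x : 'cV[R]_n, 0 <= qform M x.
Definition posdef n (M : 'M[R]_n) : Prop :=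
  M^T = M /\ forall x : 'cV[R]_n, x != 0 -> 0 < qform M x.

Definition psd_sqrt n (H M : 'M[R]_n) : Prop := psd H /\ H *m H = M.

Definition is_minimum (E : set R) (a : R) : Prop := E a /\ lbound E a.
(* The least element of E, and an arbitrary real when E has none. *)
Definition minimum (E : set R) : R := get (is_minimum E).

Definition lambda_min n (M : 'M[R]_n) : R := minimum [set a | eigenvalue M a].

Definition spectral_norm n (M : 'M[R]_n) : R :=
  sup [set norm2 (M *m x) | x in [set x : 'cV[R]_n | norm2 x <= 1]].

(* Complex eigenvalues of a real matrix. *)
Definition spectral_radius n (M : 'M[R]_n) : R :=
  sup [set ComplexField.Normc.normc z | z in
    [set z | eigenvalue (map_mx (real_complex R) M) z]].

Definition controllable n m (A : 'M[R]_n) (B : 'M[R]_(n, m)) : Prop :=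
  \rank (\mxrow_(i < n) (A ^+ i *m B)) = n.

Definition observable n p (A : 'M[R]_n) (C : 'M[R]_(p, n)) : Prop :=
  \rank (\mxcol_(i < n) (C *m A ^+ i)) = n.

Definition gradient p q (f : 'M[R]_(p, q) -> R) (X : 'M[R]_(p, q)) :
    'M[R]_(p, q) :=
  \matrix_(i, j) 'D_(delta_mx i j) f X.

End matrices.

Section random_vectors.
Context {R : realType} {d : measure_display} {T : measurableType d}.
Variable P : probability T R.

Definition borel n : set (set 'cV[R]_n) := <<s @open 'cV[R]_n >>.

Definition random_vector n (x : T -> 'cV[R]_n) : Prop :=
  measurable_fun [set: T] (x : T -> g_sigma_algebraType (@open 'cV[R]_n)).

Definition mutually_independent n (w : nat -> T -> 'cV[R]_n) : Prop :=
  forall (J : {fset nat}) (E : nat -> set 'cV[R]_n),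
    (forall t, borel (E t)) ->
    P (\bigcap_(t in [set` J]) (w t @^-1` E t)) =
    (\prod_(t <- J) P (w t @^-1` E t))%E.

Definition identically_distributed n (w : nat -> T -> 'cV[R]_n) : Prop :=
  forall (s t : nat) (E : set 'cV[R]_n), borel E ->
    P (w s @^-1` E) = P (w t @^-1` E).

Definition iid n (w : nat -> T -> 'cV[R]_n) : Prop :=
  [/\ forall t, random_vector (w t), mutually_independent w
    & identically_distributed w].

Definition finite_moment n (k : nat) (x : T -> 'cV[R]_n) : Prop :=
  ('E_P[fun o => (norm2 (x o) ^+ k)%R] < +oo)%E.

Definition mean_mx p q (X : T -> 'M[R]_(p, q)) : 'M[R]_(p, q) :=
  \matrix_(i, j) fine 'E_P[fun o => X o i j].

Section noise.
Variables (n : nat) (w : nat -> T -> 'cV[R]_n).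

(* The noise is identically distributed, so w 0 stands for any w t. *)
Definition noise_mean : 'cV[R]_n := mean_mx (w 0%N).

Definition noise_cov : 'M[R]_n :=
  mean_mx (fun o => (w 0%N o - noise_mean) *m (w 0%N o - noise_mean)^T).

Definition noise_M3 (Q : 'M[R]_n) : 'cV[R]_n :=
  mean_mx (fun o => (w 0%N o - noise_mean) *m (w 0%N o - noise_mean)^T
                    *m Q *m (w 0%N o - noise_mean)).
End noise.
End random_vectors.

Section policies.
Context {R : realType} {n m : nat}.

(* A policy X = [K, l] is an m x (n + 1) matrix: K is its left block of width
   n and l its last column. *)
Definition gain (X : 'M[R]_(m, n + 1)) : 'M[R]_(m, n) := lsubmx X.
Definition offset (X : 'M[R]_(m, n + 1)) : 'cV[R]_m := rsubmx X.

Definition control (X : 'M[R]_(m, n + 1)) (x : 'cV[R]_n) : 'cV[R]_m :=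
  - (gain X *m x) + offset X.

Variables (A : 'M[R]_n) (B : 'M[R]_(n, m)).

Definition closed_loop (X : 'M[R]_(m, n + 1)) : 'M[R]_n := A - B *m gain X.

Definition stabilizing : set 'M[R]_(m, n + 1) :=
  [set X | spectral_radius (closed_loop X) < 1].

Section moments.
Variables (wbar : 'cV[R]_n) (W : 'M[R]_n).

(* For stabilizing X each of the two equations has exactly one solution. *)
Definition stat_mean (X : 'M[R]_(m, n + 1)) : 'cV[R]_n :=
  get [set x | x = closed_loop X *m x + B *m offset X + wbar].

Definition stat_cov (X : 'M[R]_(m, n + 1)) : 'M[R]_n :=
  get [set Sg | Sg = W + closed_loop X *m Sg *m (closed_loop X)^T].

Definition Phi_mx (X : 'M[R]_(m, n + 1)) : 'M[R]_(n + 1) :=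
  block_mx (stat_cov X + stat_mean X *m (stat_mean X)^T) (- stat_mean X)
           (- (stat_mean X)^T) 1%:M.
End moments.

Section cost.
Context {d : measure_display} {T : measurableType d}.
Variables (P : probability T R) (w : nat -> T -> 'cV[R]_n).
Variables (x0 : T -> 'cV[R]_n) (Q : 'M[R]_n) (Ru : 'M[R]_m) (rhobar mu : R).

Fixpoint state (X : 'M[R]_(m, n + 1)) (t : nat) (o : T) : 'cV[R]_n :=
  if t is s.+1 then
    A *m state X s o + B *m control X (state X s o) + w s o
  else x0 o.

Definition Qmu : 'M[R]_n := Q + (4 * mu) *: (Q *m noise_cov P w *m Q).

Definition Smu : 'cV[R]_n := (2 * mu) *: (Q *m noise_M3 P w Q).

Definition stage_cost (x : 'cV[R]_n) (u : 'cV[R]_m) : R :=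
  qform Qmu x + 2 * inner x Smu + qform Ru u - mu * rhobar.

Definition lagrangian (X : 'M[R]_(m, n + 1)) : R :=
  lim ((fun N : nat => N%:R^-1 * fine 'E_P[fun o =>
    \sum_(t < N) stage_cost (state X t o) (control X (state X t o))]) @ \oo).
End cost.
End policies.

(* Main.v *)
(* Append the constant coordinate -1 to the state: z = (x, -1). Then u = - X z,
   the second moment Phi_X of z satisfies Phi = Ft Phi Ft^T + diag(W, 0) with
   Ft = At - Bt X, and L X = tr (Phi_X (Q~ + X^T R X)), so the problem is a pure
   linear-quadratic one. A value matrix P~ with
     Q~ + X^T R X + Ft^T P~ Ft - P~ = diag(0, c)
   gives, for all stabilizing Y and with D = Y - X, E = R X - Bt^T P~ Ft and
   M = R + Bt^T P~ Bt, the exact identity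
     L Y - L X = 2 tr (Phi_Y D^T E) + tr (Phi_Y D^T M D).
   Together with the continuity of Phi it yields grad L X = 2 E Phi_X, the global
   optimality of every critical point and, by completing the square at Y = X*,
     L X - L X* <= tr (Phi* E^T E) / sigma(R).
   A minimizer, and the minimum sigma_alpha, exist because the sublevel sets are
   compact: X is stabilizing iff P = Q_K + F^T P F has a positive semidefinite
   solution (observability), L X equals tr (W P) plus the cost of the stationary
   mean, and the triples (X, P, mean) of cost at most alpha form a closed bounded
   set. The initial state need not be independent of the noise, its contribution
   being damped by F^t. *)

(* The weight in the cost identity is the moment of the policy reached, not of the policy left.
   Based at X and evaluated at X*, it is weighted by Phi*, and after completing the square X
   survives only through E. So ||Phi*|| comes from bounding tr (Phi* E^T E), sigma_alpha from
   recovering E out of grad L X = 2 E Phi_X, the 4 from that factor 2, and sigma(R) from M >= R.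
   Three obstacles shape the rest. The augmented loop keeps the eigenvalue 1 of the constant
   coordinate, so the value matrix cannot come from one Lyapunov equation; hence the leftover
   diag(0, c). The linear cost 2 x^T S is unbounded, but S = Q (2 mu M3) lies in the range of Q and
   is absorbed into a square for Q. Finally [minimum], [get], [sup] and [lim] have default values,
   so each use needs an existence or boundedness proof; since every critical point is a global
   minimizer, whichever one [get] selects has cost L*. *)
Require Import Defs.
From mathcomp Require Import all_boot all_order all_algebra.
From mathcomp Require Import ring lra complex finmap.
From mathcomp Require Import all_classical all_reals all_analysis.
From mathcomp Require Import measurable_realfun.
Import Order.TTheory GRing.Theory Num.Theory.
Import numFieldNormedType.Exports.
Local Open Scope classical_set_scope.
Local Open Scope ring_scope.

Set Implicit Arguments.
Unset Strict Implicit.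
Unset Printing Implicit Defensive.

(** * Quadratic forms *)

Section quadratic_forms.
Context {R : realType}.
Implicit Types n p : nat.

Lemma innerE n (x y : 'cV[R]_n) : inner x y = \sum_i x i 0 * y i 0.
Proof. by rewrite /inner mxE; apply: eq_bigr => i _; rewrite mxE. Qed.

Lemma innerC n (x y : 'cV[R]_n) : inner x y = inner y x.
Proof. by rewrite !innerE; apply: eq_bigr => i _; rewrite mulrC. Qed.

Lemma innerDr n (x y z : 'cV[R]_n) : inner x (y + z) = inner x y + inner x z.
Proof. by rewrite /inner mulmxDr mxE. Qed.

Lemma innerDl n (x y z : 'cV[R]_n) : inner (x + y) z = inner x z + inner y z.
Proof. by rewrite innerC innerDr !(innerC z). Qed.

Lemma innerZr n a (x y : 'cV[R]_n) : inner x (a *: y) = a * inner x y.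
Proof. by rewrite /inner -scalemxAr mxE. Qed.

Lemma innerZl n a (x y : 'cV[R]_n) : inner (a *: x) y = a * inner x y.
Proof. by rewrite innerC innerZr innerC. Qed.

Lemma innerNr n (x y : 'cV[R]_n) : inner x (- y) = - inner x y.
Proof. by rewrite -scaleN1r innerZr mulN1r. Qed.

Lemma innerNl n (x y : 'cV[R]_n) : inner (- x) y = - inner x y.
Proof. by rewrite innerC innerNr innerC. Qed.

Lemma inner0r n (x : 'cV[R]_n) : inner x 0 = 0.
Proof. by rewrite /inner mulmx0 mxE. Qed.

Lemma inner0l n (x : 'cV[R]_n) : inner 0 x = 0.
Proof. by rewrite innerC inner0r. Qed.

Lemma inner_mulmx n p (M : 'M[R]_(p, n)) (x : 'cV[R]_p) (y : 'cV[R]_n) :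
  inner x (M *m y) = inner (M^T *m x) y.
Proof. by rewrite /inner trmx_mul trmxK mulmxA. Qed.

Lemma inner_ge0 n (x : 'cV[R]_n) : 0 <= inner x x.
Proof. by rewrite innerE sumr_ge0// => i _; rewrite -expr2 sqr_ge0. Qed.

Lemma inner_eq0 n (x : 'cV[R]_n) : (inner x x == 0) = (x == 0).
Proof.
apply/eqP/eqP => [|->]; last by rewrite inner0r.
rewrite innerE => h; apply/colP => i; rewrite mxE; apply/eqP.
rewrite -sqrf_eq0 expr2; apply/eqP; move: i isT.
by apply: psumr_eq0P => // j _; rewrite -expr2 sqr_ge0.
Qed.

Lemma inner_gt0 n (x : 'cV[R]_n) : (0 < inner x x) = (x != 0).
Proof. by rewrite lt_neqAle inner_ge0 andbT eq_sym inner_eq0. Qed.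

Lemma cauchy_schwarz n (x y : 'cV[R]_n) :
  inner x y ^+ 2 <= inner x x * inner y y.
Proof.
have [->|y0] := eqVneq y 0; first by rewrite !inner0r mulr0 expr0n.
have yy : 0 < inner y y by rewrite inner_gt0.
(* The residual of projecting x on y, scaled by |y|^2 to avoid a division. *)
have := inner_ge0 (inner y y *: x - inner x y *: y).
rewrite innerDl !innerDr !innerNl !innerNr !innerZl !innerZr (innerC y x).
set a := inner x x; set b := inner x y; set c := inner y y in yy *.
have -> : c * (c * a) - c * (b * b) + (- (b * (c * b)) - - (b * (b * c)))
  = c * (a * c - b ^+ 2) by ring.
by rewrite pmulr_rge0// subr_ge0.
Qed.

Lemma norm2_ge0 n (x : 'cV[R]_n) : 0 <= norm2 x.
Proof. exact: sqrtr_ge0. Qed.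

Lemma norm2_sqr n (x : 'cV[R]_n) : norm2 x ^+ 2 = inner x x.
Proof. by rewrite sqr_sqrtr// inner_ge0. Qed.

Lemma norm2_eq0 n (x : 'cV[R]_n) : (norm2 x == 0) = (x == 0).
Proof. by rewrite -inner_eq0 -norm2_sqr sqrf_eq0. Qed.

Lemma inner_le_norm2 n (x y : 'cV[R]_n) : inner x y <= norm2 x * norm2 y.
Proof.
apply: le_trans (ler_norm _) _.
rewrite -ler_sqr ?nnegrE ?mulr_ge0 ?norm2_ge0 ?normr_ge0//.
by rewrite real_normK ?num_real// exprMn !norm2_sqr cauchy_schwarz.
Qed.

Lemma norm2Z n a (x : 'cV[R]_n) : 0 <= a -> norm2 (a *: x) = a * norm2 x.
Proof.
move=> a0; rewrite /norm2 innerZl innerZr mulrA -expr2 sqrtrM ?sqr_ge0//.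
by rewrite sqrtr_sqr ger0_norm.
Qed.

Lemma frobenius_bound n p (M : 'M[R]_(p, n)) (x : 'cV[R]_n) :
  inner (M *m x) (M *m x) <= \tr (M *m M^T) * inner x x.
Proof.
rewrite innerE /mxtrace mulr_suml; apply: ler_sum => i _.
have -> : (M *m x) i 0 = inner (row i M)^T x.
  by rewrite /inner trmxK -row_mul [RHS]mxE.
rewrite -expr2; apply: le_trans (cauchy_schwarz _ _) _.
rewrite le_eqVlt; apply/orP; left; apply/eqP; congr (_ * _).
by rewrite innerE mxE; apply: eq_bigr => j _; rewrite !mxE.
Qed.

(** [spectral_norm] is a bare [sup], so its set must first be bounded above; the Frobenius norm does
    this. The general case follows by rescaling x to the unit sphere. *)
Lemma norm2_mulmx_le n (M : 'M[R]_n) (x : 'cV[R]_n) :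
  norm2 (M *m x) <= spectral_norm M * norm2 x.
Proof.
set E := [set norm2 (M *m x) | x in [set x : 'cV[R]_n | norm2 x <= 1]].
have ubE : ubound E (Num.sqrt (\tr (M *m M^T))).
  move=> _ [y /= y1 <-]; rewrite ler_sqrt; last first.
    by rewrite mxtrace_mulC; apply: sumr_ge0 => i _; rewrite mxE;
      apply: sumr_ge0 => j _; rewrite mxE -expr2 sqr_ge0.
  apply: le_trans (frobenius_bound _ _) _; rewrite ler_piMr//.
    by rewrite mxtrace_mulC; apply: sumr_ge0 => i _; rewrite mxE;
      apply: sumr_ge0 => j _; rewrite mxE -expr2 sqr_ge0.
  by rewrite -norm2_sqr expr_le1// norm2_ge0.
have [->|x0] := eqVneq x 0.
  by rewrite mulmx0 /norm2 !inner0r sqrtr0 mulr0.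
have nx : 0 < norm2 x by rewrite lt_neqAle norm2_ge0 eq_sym norm2_eq0 x0.
rewrite -ler_pdivrMr// mulrC -norm2Z ?invr_ge0 ?norm2_ge0//.
rewrite scalemxAr; apply: ub_le_sup; first by eexists; exact: ubE.
exists ((norm2 x)^-1 *: x) => //=.
by rewrite norm2Z ?invr_ge0 ?norm2_ge0// mulVf// gt_eqF.
Qed.

Lemma qformD n (M : 'M[R]_n) (x y : 'cV[R]_n) : M^T = M ->
  qform M (x + y) = qform M x + 2 * inner x (M *m y) + qform M y.
Proof.
move=> sM; rewrite /qform mulmxDr innerDl !innerDr.
by rewrite (inner_mulmx _ y x) sM (innerC _ x); ring.
Qed.

Lemma qformZ n (M : 'M[R]_n) a (x : 'cV[R]_n) :
  qform M (a *: x) = a ^+ 2 * qform M x.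
Proof. by rewrite /qform -scalemxAr innerZl innerZr mulrA expr2. Qed.

Lemma qform_addmx n (M N : 'M[R]_n) x : qform (M + N) x = qform M x + qform N x.
Proof. by rewrite /qform mulmxDl innerDr. Qed.

Lemma qform_oppmx n (M : 'M[R]_n) x : qform (- M) x = - qform M x.
Proof. by rewrite /qform mulNmx innerNr. Qed.

Lemma qform_scalemx n a (M : 'M[R]_n) x : qform (a *: M) x = a * qform M x.
Proof. by rewrite /qform -scalemxAl innerZr. Qed.

Lemma qform1 n (x : 'cV[R]_n) : qform 1%:M x = inner x x.
Proof. by rewrite /qform mul1mx. Qed.

Lemma qform_congr n p (M : 'M[R]_n) (Y : 'M[R]_(n, p)) x :
  qform (Y^T *m M *m Y) x = qform M (Y *m x).
Proof. by rewrite /qform -!mulmxA inner_mulmx trmxK. Qed.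

Lemma trmx_congr n p (M : 'M[R]_n) (Y : 'M[R]_(n, p)) :
  M^T = M -> (Y^T *m M *m Y)^T = Y^T *m M *m Y.
Proof. by move=> sM; rewrite !trmx_mul trmxK sM mulmxA. Qed.

Lemma psd_congr n p (M : 'M[R]_n) (Y : 'M[R]_(n, p)) :
  psd M -> psd (Y^T *m M *m Y).
Proof.
by move=> [sM M0]; split=> [|x]; [exact: trmx_congr|rewrite qform_congr].
Qed.

Lemma psd_gram n p (Y : 'M[R]_(n, p)) : psd (Y^T *m Y).
Proof.
rewrite -[Y^T]mulmx1; apply: psd_congr; split; first exact: trmx1.
by move=> x; rewrite qform1 inner_ge0.
Qed.

Lemma psdD n (M N : 'M[R]_n) : psd M -> psd N -> psd (M + N).
Proof.
move=> [sM M0] [sN N0]; split; first by rewrite linearD /= sM sN.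
by move=> x; rewrite qform_addmx addr_ge0.
Qed.

Lemma psdZ n a (M : 'M[R]_n) : 0 <= a -> psd M -> psd (a *: M).
Proof.
move=> a0 [sM M0]; split; first by rewrite linearZ /= sM.
by move=> x; rewrite qform_scalemx mulr_ge0.
Qed.

Lemma posdef_psd n (M : 'M[R]_n) : posdef M -> psd M.
Proof.
move=> [sM M0]; split=> // x; have [->|x0] := eqVneq x 0.
  by rewrite /qform inner0l.
exact/ltW/M0.
Qed.

Lemma inner_block n p (a : 'cV[R]_n) (b : 'cV[R]_p) (c : 'cV[R]_n)
    (e : 'cV[R]_p) :
  inner (col_mx a b) (col_mx c e) = inner a c + inner b e.
Proof. by rewrite /inner tr_col_mx mul_row_col mxE. Qed.

(* Cholesky: peel off the first coordinate and pass to the Schur complement. *)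
Lemma psd_factor n (M : 'M[R]_n) : psd M -> exists C : 'M[R]_n, M = C^T *m C.
Proof.
elim: n M => [|n IH] M [sM M0]; first by exists 0; apply/matrixP => -[].
pose M' : 'M[R]_(1 + n) := M.
suff [C hC] : exists C : 'M[R]_(1 + n), M' = C^T *m C by exists C.
have M'0 x : 0 <= qform M' x by exact: M0.
have [a [b [D defM]]] : exists (a : R) (b : 'cV[R]_n) (D : 'M[R]_n),
  M' = block_mx a%:M b^T b D.
  exists (ulsubmx M' 0 0), (dlsubmx M'), (drsubmx M').
  rewrite -mx11_scalar -[in LHS](submxK M'); congr block_mx.
  by rewrite trmx_dlsub (sM : M'^T = M').
have q (s : R) (v : 'cV[R]_n) : qform M' (col_mx s%:M v)
    = a * s ^+ 2 + 2 * s * inner b v + qform D v.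
  rewrite defM /qform mul_block_col inner_block !innerDr.
  rewrite -scalar_mxM !mul_mx_scalar !innerZr.
  have -> : inner s%:M (a * s)%:M = a * s ^+ 2.
    by rewrite /inner tr_scalar_mx -scalar_mxM mxE eqxx mulr1n; ring.
  have -> : inner s%:M (b^T *m v) = s * inner b v.
    by rewrite /inner tr_scalar_mx mul_scalar_mx mxE.
  by rewrite (innerC v b); ring.
have sD : D^T = D.
  have := sM : M'^T = M'; rewrite defM tr_block_mx => /eq_block_mx.
  by case.
have a0 : 0 <= a.
  by have := M'0 (col_mx 1%:M 0);
    rewrite q inner0r /qform inner0l !mulr1 expr1n; lra.
have [a00|ane] := eqVneq a 0.
  (* With a zero pivot the form is affine in the first coordinate; if b were nonzero, that
     coordinate could be chosen to give the value -1. *)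
  have b0 : b = 0.
    apply/eqP; rewrite -inner_eq0 eq_le inner_ge0 andbT leNgt; apply/negP => bb.
    have := M'0 (col_mx (- ((qform D b + 1) / (2 * inner b b)))%:M b).
    rewrite q a00; set c := inner b b in bb *.
    have -> : 0 * (- ((qform D b + 1) / (2 * c))) ^+ 2 +
      2 * - ((qform D b + 1) / (2 * c)) * c + qform D b = -1 by field;
        rewrite gt_eqF.
    lra.
  have /IH[C DC] : psd D.
    split=> // v; have := M'0 (col_mx 0%:M v).
    by rewrite q expr0n !mulr0 mul0r !add0r.
  exists (block_mx 0 0 0 C).
  rewrite defM a00 b0 DC trmx0.
  rewrite tr_block_mx !trmx0 mulmx_block !mulmx0 !mul0mx !addr0 !add0r.
  by congr block_mx; rewrite raddf0.
have {ane a0} a0 : 0 < a by rewrite lt_neqAle eq_sym ane.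
have /IH[C DC] : psd (D - a^-1 *: (b *m b^T)).
  split.
    by rewrite linearB /= sD linearZ /= trmx_mul trmxK.
  move=> v; rewrite qform_addmx qform_oppmx qform_scalemx.
  have -> : qform (b *m b^T) v = inner b v ^+ 2.
    rewrite /qform -mulmxA inner_mulmx /inner trmx_mul trmxK.
    by rewrite [v^T *m b]mx11_scalar mul_scalar_mx mxE -/(inner _ _) innerC
      expr2.
  (* This first coordinate minimizes the form for fixed v; the minimum is the Schur complement. *)
  have := M'0 (col_mx (- (inner b v / a))%:M v); rewrite q.
  set u := inner b v.
  have -> : a * (- (u / a)) ^+ 2 + 2 * (- (u / a)) * u + qform D v =
     qform D v - a^-1 * u ^+ 2 by field; rewrite gt_eqF.
  by [].
pose r := Num.sqrt a.
have r0 : 0 < r by rewrite sqrtr_gt0.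
have rr : r * r = a by rewrite -expr2 sqr_sqrtr// ltW.
exists (block_mx r%:M (r^-1 *: b^T) 0 C).
rewrite defM.
rewrite tr_block_mx tr_scalar_mx linearZ /= trmxK trmx0 mulmx_block.
rewrite -DC !mul0mx !mulmx0 !addr0 -scalar_mxM rr.
rewrite !mul_scalar_mx !mul_mx_scalar !scalerA mulfV ?gt_eqF// !scale1r.
rewrite -scalemxAl -scalemxAr scalerA -invfM rr.
by rewrite addrC subrK.
Qed.

Lemma mxtrace_gram n p (N : 'M[R]_n) (C : 'M[R]_(p, n)) :
  \tr (C *m N *m C^T) = \sum_i qform N (row i C)^T.
Proof.
apply: eq_bigr => i _; rewrite /qform /inner trmxK mulmxA -row_mul.
by rewrite [LHS]mxE [RHS]mxE; apply: eq_bigr => j _; congr (_ * _);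
  rewrite !mxE.
Qed.

(** Factoring M = C^T C turns the trace into a sum of values of N on the rows of C. *)
Lemma mxtrace_psd_mul_ge0 n (M N : 'M[R]_n) :
    psd M -> psd N -> 0 <= \tr (M *m N).
Proof.
move=> /psd_factor[C ->] [_ N0]; rewrite -mulmxA mxtrace_mulC mxtrace_gram.
exact: sumr_ge0.
Qed.

Lemma mxtrace_congr_ge0 n p (M : 'M[R]_n) (N : 'M[R]_p) (Y : 'M[R]_(p, n)) :
  psd M -> psd N -> 0 <= \tr (M *m (Y^T *m N *m Y)).
Proof. by move=> M0 N0; apply: mxtrace_psd_mul_ge0 => //; exact: psd_congr. Qed.

Lemma psd_qform_eq0 n (M : 'M[R]_n) x : psd M -> qform M x = 0 -> M *m x = 0.
Proof.
move=> /psd_factor[C ->]; rewrite -[C^T]mulmx1 qform_congr qform1.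
by move/eqP; rewrite inner_eq0 mulmx1 -mulmxA => /eqP ->; rewrite mulmx0.
Qed.

Lemma ker0_linv n p (M : 'M[R]_(p, n)) :
  (forall x : 'cV[R]_n, M *m x = 0 -> x = 0) ->
  exists N : 'M[R]_(n, p), N *m M = 1%:M.
Proof.
move=> h; have /row_freeP[B hB] : row_free M^T.
  apply: inj_row_free => v vM; apply: trmx_inj; rewrite trmx0; apply: h.
  by rewrite -(trmxK M) -trmx_mul vM trmx0.
by exists B^T; rewrite -(trmxK M) -trmx_mul hB trmx1.
Qed.

End quadratic_forms.

(** * Limits of matrices *)

Section matrix_limits.
Context {R : realType} {T : Type} {F : set_system T} {FF : Filter F}.

Lemma cvg_mxP m n (f : T -> 'M[R]_(m, n)) (M : 'M[R]_(m, n)) :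
  f @ F --> M <-> forall i j, (fun t => f t i j) @ F --> M i j.
Proof.
split=> [fM i j|h]; first exact: (cvg_comp _ _ fM (@coord_continuous _ _ _ i j
  M)).
move=> A [B MB sBA].
have : \forall t \near F, forall i j, B i j (f t i j).
  apply: filter_forall => i; apply: filter_forall => j.
  exact: h (MB i j).
by apply: filterS => t Bt; exact: sBA.
Qed.

Lemma cvg_sumr I (r : seq I) (f : I -> T -> R) (a : I -> R) :
  (forall i, f i @ F --> a i) ->
  (fun t => \sum_(i <- r) f i t) @ F --> \sum_(i <- r) a i.
Proof.
move=> fa; elim: r => [|i r IH].
  by under eq_fun do rewrite big_nil; rewrite big_nil; exact: cvg_cst.
by under eq_fun do rewrite big_cons; rewrite big_cons; exact: cvgD.
Qed.

Lemma cvg_prodr I (r : seq I) (f : I -> T -> R) (a : I -> R) :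
  (forall i, f i @ F --> a i) ->
  (fun t => \prod_(i <- r) f i t) @ F --> \prod_(i <- r) a i.
Proof.
move=> fa; elim: r => [|i r IH].
  by under eq_fun do rewrite big_nil; rewrite big_nil; exact: cvg_cst.
by under eq_fun do rewrite big_cons; rewrite big_cons; exact: cvgM.
Qed.

Lemma cvg_mulmx m n p (f : T -> 'M[R]_(m, n)) (g : T -> 'M[R]_(n, p))
    (M : 'M[R]_(m, n)) (N : 'M[R]_(n, p)) :
  f @ F --> M -> g @ F --> N -> (fun t => f t *m g t) @ F --> M *m N.
Proof.
move=> /cvg_mxP fM /cvg_mxP gN; apply/cvg_mxP => i j; rewrite mxE.
under eq_fun do rewrite mxE.
by apply: cvg_sumr => k; exact: cvgM.
Qed.

Lemma cvg_trmx m n (f : T -> 'M[R]_(m, n)) (M : 'M[R]_(m, n)) :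
  f @ F --> M -> (fun t => (f t)^T) @ F --> M^T.
Proof.
move=> /cvg_mxP fM; apply/cvg_mxP => i j; rewrite mxE.
by under eq_fun do rewrite mxE; exact: fM.
Qed.

Lemma cvg_mxtrace n (f : T -> 'M[R]_n) (M : 'M[R]_n) :
  f @ F --> M -> (fun t => \tr (f t)) @ F --> \tr M.
Proof. by move=> /cvg_mxP fM; apply: cvg_sumr => i. Qed.

Lemma cvg_block_mx m1 m2 n1 n2 (f1 : T -> 'M[R]_(m1, n1))
    (f2 : T -> 'M[R]_(m1, n2)) (f3 : T -> 'M[R]_(m2, n1))
    (f4 : T -> 'M[R]_(m2, n2)) (M1 : 'M[R]_(m1, n1)) (M2 : 'M[R]_(m1, n2))
    (M3 : 'M[R]_(m2, n1)) (M4 : 'M[R]_(m2, n2)) :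
  f1 @ F --> M1 -> f2 @ F --> M2 -> f3 @ F --> M3 -> f4 @ F --> M4 ->
  (fun t => block_mx (f1 t) (f2 t) (f3 t) (f4 t)) @ F
    --> block_mx M1 M2 M3 M4.
Proof.
move=> /cvg_mxP h1 /cvg_mxP h2 /cvg_mxP h3 /cvg_mxP h4; apply/cvg_mxP => i j.
rewrite -(splitK i) -(splitK j).
case: (fintype.split i) => i'; case: (fintype.split j) => j' /=.
- by rewrite block_mxEul; under eq_fun do rewrite block_mxEul; exact: h1.
- by rewrite block_mxEur; under eq_fun do rewrite block_mxEur; exact: h2.
- by rewrite block_mxEdl; under eq_fun do rewrite block_mxEdl; exact: h3.
- by rewrite block_mxEdr; under eq_fun do rewrite block_mxEdr; exact: h4.
Qed.

Lemma cvg_linear m n p q (g : {linear 'M[R]_(m, n) -> 'M[R]_(p, q)})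
    (f : T -> 'M[R]_(m, n)) (M : 'M[R]_(m, n)) :
  f @ F --> M -> (fun t => g (f t)) @ F --> g M.
Proof.
have gE N : g N = \sum_i \sum_j N i j *: g (delta_mx i j).
  rewrite {1}[N]matrix_sum_delta linear_sum; apply: eq_bigr => i _.
  by rewrite linear_sum; apply: eq_bigr => j _; rewrite linearZ.
move=> /cvg_mxP fM; apply/cvg_mxP => i j; rewrite gE.
under eq_fun do rewrite gE summxE; rewrite summxE.
apply: cvg_sumr => k; under eq_fun do rewrite summxE; rewrite summxE.
apply: cvg_sumr => l; under eq_fun do rewrite mxE; rewrite mxE.
by apply: cvgMr_tmp; exact: fM.
Qed.

Lemma cvg_det n (f : T -> 'M[R]_n) (M : 'M[R]_n) :
  f @ F --> M -> (fun t => \det (f t)) @ F --> \det M.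
Proof.
move=> /cvg_mxP fM; apply: cvg_sumr => s; apply: cvgM; first exact: cvg_cst.
by apply: cvg_prodr => i; exact: fM.
Qed.

Lemma cvg_invmx n (f : T -> 'M[R]_n) (M : 'M[R]_n) : M \in unitmx ->
  f @ F --> M -> (fun t => invmx (f t)) @ F --> invmx M.
Proof.
move=> uM fM; have dM : \det M != 0 by rewrite -unitfE -unitmxE.
have cvg : (fun t => (\det (f t))^-1 *: \adj (f t)) @ F --> invmx M.
  rewrite /invmx uM; apply/cvg_mxP => i j; rewrite mxE.
  under eq_fun do rewrite mxE.
  apply: cvgM; first by apply: cvgV => //; exact: cvg_det.
  rewrite mxE /cofactor; under eq_fun do rewrite mxE /cofactor.
  apply: cvgM; first exact: cvg_cst.
  apply: cvg_det; apply/cvg_mxP => k l; rewrite !mxE.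
  by under eq_fun do rewrite !mxE; move/cvg_mxP: fM; apply.
(* [invmx] follows the adjugate formula only on invertible matrices; the determinant is eventually
   nonzero, so the two agree along the filter. *)
apply: cvg_trans cvg; apply: near_eq_cvg.
have : \forall t \near F, \det (f t) != 0.
  have := cvg_det fM => /cvgrPdist_lt /(_ `|\det M|).
  rewrite normr_gt0 => /(_ dM); apply: filterS => t.
  by apply: contraTneq => ->; rewrite subr0 ltxx.
by apply: filterS => t dt; rewrite /invmx unitmxE unitfE dt.
Qed.

Lemma cvg_qform n (M : 'M[R]_n) (f : T -> 'cV[R]_n) (x : 'cV[R]_n) :
  f @ F --> x -> (fun t => qform M (f t)) @ F --> qform M x.
Proof.
move=> fx; rewrite /qform /inner.
suff /cvg_mxP : (fun t => (f t)^T *m (M *m f t)) @ F --> x^T *m (M *m x) by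
  exact.
apply: cvg_mulmx; first exact: cvg_trmx.
by apply: cvg_mulmx => //; exact: cvg_cst.
Qed.

(** Meant for the correlation of the initial state with the noise: it need not converge, but it is
    bounded and multiplied by a vanishing power of the closed loop. *)
Lemma cvg_mulmx0_bounded p q r (M : T -> 'M[R]_(p, q)) (N : T -> 'M[R]_(q, r))
    (b : T -> 'M[R]_(q, r)) (c : 'M[R]_(q, r)) :
  M @ F --> (0 : 'M[R]_(p, q)) -> (forall t i j, `|N t i j| <= b t i j) ->
  b @ F --> c -> (fun t => M t *m N t) @ F --> (0 : 'M[R]_(p, r)).
Proof.
move=> /cvg_mxP M0 Nb /cvg_mxP bc; apply/cvg_mxP => i j; rewrite mxE.
apply/norm_cvg0P.
have c0 : (fun t => \sum_k `|M t i k| * b t k j) @ F --> 0.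
  have h k : (fun t => `|M t i k| * b t k j) @ F --> `|(0 : 'M[R]_(p,
    q)) i k| * c k j.
    exact: cvgM (cvg_norm (M0 i k)) (bc k j).
  have e0 : \sum_k `|(0 : 'M[R]_(p, q)) i k| * c k j = 0.
    by rewrite big1// => k _; rewrite mxE normr0 mul0r.
  by have := cvg_sumr (r := index_enum _) h; rewrite e0; exact.
apply: squeeze_cvgr (cvg_cst 0) c0; apply: nearW => t.
rewrite normr_ge0 mxE /=; apply: le_trans (ler_norm_sum _ _ _) _.
by apply: ler_sum => k _; rewrite normrM ler_wpM2l.
Qed.

End matrix_limits.

(** * Compactness, attained minima and the smallest eigenvalue *)

Section compactness.
Context {R : realType}.

Lemma minimumP (E : set R) a : is_minimum E a -> minimum E = a.
Proof.
move=> Ea; apply: get_unique => // b [Eb lb]; case: Ea => Ea la.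
by apply/eqP; rewrite eq_le lb// la.
Qed.

Lemma closed_le_cts (U : topologicalType) (f g : U -> R) :
  continuous f -> continuous g -> closed [set x | f x <= g x].
Proof.
move=> cf cg; rewrite (_ : mkset _ = (fun x => f x - g x) @^-1` [set y | y <=
  0]).
  by apply: closed_comp (@closed_le _ 0) => x _; apply: cvgB;
    [exact: cf|exact: cg].
by apply/seteqP; split=> x /=; rewrite subr_le0.
Qed.

Lemma closed_eq_cts (U : topologicalType) m n (f g : U -> 'M[R]_(m, n)) :
  continuous f -> continuous g -> closed [set x | f x = g x].
Proof.
move=> cf cg; rewrite (_ : mkset _ =
    \bigcap_(ij in setT) [set x | f x ij.1 ij.2 = g x ij.1 ij.2]); last first.
  by apply/seteqP; split=> x /=; [move=> h ij _ /=; rewrite h|move=> h;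
    apply/matrixP => i j; exact: (h (i, j))].
apply: closed_bigI => -[i j] _ /=.
rewrite (_ : mkset _ = [set x | f x i j <= g x i j] `&` [set x | g x i j <= f x
  i j]).
  have c1 : continuous (fun x => f x i j) by move=> x; move/cvg_mxP: (cf x);
    apply.
  have c2 : continuous (fun x => g x i j) by move=> x; move/cvg_mxP: (cg x);
    apply.
  by apply: closedI; apply: closed_le_cts.
apply/seteqP; split=> x /=; first by move=> ->.
by move=> [h1 h2]; apply/eqP; rewrite eq_le h1.
Qed.

Lemma compact_mx_box m n (c : R) :
  compact [set M : 'M[R]_(m, n) | forall i j, `|M i j| <= c].
Proof.
pose B := [set v : 'rV[R]_(m * n) | forall k, `[- c, c]%classic (v 0 k)].
have cB : compact B by apply: (@rV_compact _ _ (fun=> `[- c,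
  c]%classic)) => _; exact: segment_compact.
rewrite (_ : mkset _ = (vec_mx : _ -> 'M[R]_(m, n)) @` B).
  apply: continuous_compact => //; apply: continuous_subspaceT => v.
  exact: (@cvg_linear R _ (nbhs v) _ _ _ _ _ (@vec_mx R m n) id v cvg_id).
apply/seteqP; split=> M /=.
  move=> h; exists (mxvec M); last exact: mxvecK.
  move=> k /=; case/mxvec_indexP: k => i j.
  by rewrite mxvecE in_itv /= -ler_norml.
move=> [v h <-] i j; have := h (mxvec_index i j).
by rewrite mxE /= in_itv /= -ler_norml.
Qed.

Lemma bounded_closed_compact_mx m n (A : set 'M[R]_(m, n)) (c : R) :
  closed A -> (forall M, A M -> forall i j, `|M i j| <= c) -> compact A.
Proof. by move=> clA bA; apply: subclosed_compact clA (@compact_mx_box m n c) _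
  => M /bA. Qed.

Lemma inner_coord_le n (v : 'cV[R]_n) i : v i 0 ^+ 2 <= inner v v.
Proof.
rewrite innerE (bigD1 i)//= -expr2 lerDl sumr_ge0// => j _.
by rewrite -expr2 sqr_ge0.
Qed.

Lemma qform_continuous n (M : 'M[R]_n) : continuous (qform M).
Proof. by move=> v; exact: (@cvg_qform R _ (nbhs v) _ n M id v cvg_id). Qed.

Lemma inner_continuous n : continuous (fun v : 'cV[R]_n => inner v v).
Proof.
have -> : (fun v : 'cV[R]_n => inner v v) = qform 1%:M.
  by apply/funext => v; rewrite qform1.
exact: qform_continuous.
Qed.

Lemma sphere_compact n : compact [set v : 'cV[R]_n | inner v v = 1].
Proof.
apply: (@bounded_closed_compact_mx _ _ _ 1).
  rewrite (_ : mkset _ = [set v | inner v v <= cst 1 v] `&` [set v | cst 1 v <=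
    inner v v]).
    by apply: closedI; apply: closed_le_cts;
      by [exact: inner_continuous|exact: cst_continuous].
  apply/seteqP; split=> v /=; first by move=> ->.
  by move=> [h1 h2]; apply/eqP; rewrite eq_le h1.
move=> v /= v1 i j; rewrite ord1 -ler_sqr ?nnegrE//.
by rewrite expr1n real_normK ?num_real// -v1 inner_coord_le.
Qed.

Lemma sphere_nonempty n : (0 < n)%N ->
    [set v : 'cV[R]_n | inner v v = 1] !=set0.
Proof.
case: n => // n _; exists (delta_mx 0 0);
  rewrite /= innerE (bigD1 ord0)//= big1.
  by rewrite !mxE !eqxx mulr1 addr0.
by move=> i /negbTE i0; rewrite !mxE i0 mul0r.
Qed.

Lemma qform_ge_sphere n (M : 'M[R]_n) c :
  (forall v, inner v v = 1 -> c <= qform M v) ->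
  forall x, c * inner x x <= qform M x.
Proof.
move=> h x; have [->|x0] := eqVneq x 0.
  by rewrite inner0r mulr0 /qform inner0l.
have nx : 0 < norm2 x by rewrite lt_neqAle norm2_ge0 eq_sym norm2_eq0 x0.
have x1 : inner ((norm2 x)^-1 *: x) ((norm2 x)^-1 *: x) = 1.
  by rewrite innerZl innerZr -norm2_sqr; field; rewrite gt_eqF.
have := h _ x1; rewrite qformZ exprVn norm2_sqr.
by rewrite ler_pdivlMl ?inner_gt0// mulrC.
Qed.

(** Rayleigh's principle. If l is the minimum of the form on the sphere, attained at v, then M - l
    is positive semidefinite and its form vanishes at v, so v lies in its kernel. [eigenvalue]
    speaks of row vectors, whence the transposes. *)
Lemma lambda_min_attained n (M : 'M[R]_n) : (0 < n)%N -> M^T = M ->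
  is_minimum [set a | eigenvalue M a] (lambda_min M) /\
  forall x, lambda_min M * inner x x <= qform M x.
Proof.
move=> n0 sM.
have [|v] := @compact_EVT_min _ R (qform M) _ (sphere_nonempty n0)
  (@sphere_compact n).
  by apply: continuous_subspaceT; exact: qform_continuous.
rewrite inE /= => v1 hv; set l := qform M v in hv.
have ge_l : forall x, l * inner x x <= qform M x.
  by apply: qform_ge_sphere => x x1; apply: hv; rewrite inE.
have v0 : v != 0 by rewrite -inner_eq0 v1 oner_neq0.
have Mv : M *m v = l *: v.
  apply/eqP; rewrite -subr_eq0 -mul_scalar_mx -mulmxBl; apply/eqP.
  apply: psd_qform_eq0; last first.
    by rewrite qform_addmx qform_oppmx -scalemx1 qform_scalemx qform1 v1 mulr1
      subrr.
  split; first by rewrite linearB /= sM tr_scalar_mx.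
  by move=> x; rewrite qform_addmx qform_oppmx -scalemx1 qform_scalemx qform1
    subr_ge0.
have lmin : is_minimum [set a | eigenvalue M a] l.
  split=> /=.
    apply/eigenvalueP; exists v^T; last by rewrite trmx_eq0.
    by rewrite -[in LHS]sM -trmx_mul Mv linearZ.
  move=> a /eigenvalueP[x xM x0].
  have x0' : 0 < inner x^T x^T by rewrite inner_gt0 trmx_eq0.
  rewrite -(ler_pM2r x0'); apply: le_trans (ge_l _) _.
  by rewrite /qform -[in M *m _]sM -trmx_mul xM linearZ innerZr.
by rewrite /lambda_min (minimumP lmin).
Qed.

Lemma lambda_min_le n (M : 'M[R]_n) x : (0 < n)%N -> M^T = M ->
  lambda_min M * inner x x <= qform M x.
Proof. by move=> n0 sM; case: (lambda_min_attained n0 sM) => _; exact. Qed.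

Lemma lambda_min_eigenvector n (M : 'M[R]_n) : (0 < n)%N -> M^T = M ->
  exists2 v, inner v v = 1 & qform M v = lambda_min M.
Proof.
move=> n0 sM; have [[/= /eigenvalueP[v vM v0] _] _] := lambda_min_attained n0
  sM.
have nv : 0 < norm2 v^T by rewrite lt_neqAle norm2_ge0 eq_sym norm2_eq0
  trmx_eq0 v0.
exists ((norm2 v^T)^-1 *: v^T).
  by rewrite innerZl innerZr -norm2_sqr; field; rewrite gt_eqF.
rewrite qformZ /qform -[in M *m _]sM -trmx_mul vM linearZ /= innerZr -norm2_sqr.
by field; rewrite gt_eqF.
Qed.

Lemma lambda_min_gt0 n (M : 'M[R]_n) :
    (0 < n)%N -> posdef M -> 0 < lambda_min M.
Proof.
move=> n0 [sM M0]; have [v v1 <-] := lambda_min_eigenvector n0 sM.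
by apply: M0; rewrite -inner_eq0 v1 oner_neq0.
Qed.

End compactness.

(** * Stability and Lyapunov equations *)

Section stability.
Context {R : realType}.
Local Notation normc := (@ComplexField.Normc.normc R).
Local Notation cplx := (real_complex R).
Local Notation C := (R[i])%C.

Lemma normc_ge0 (z : C) : 0 <= normc z.
Proof. by case: z => a b; exact: sqrtr_ge0. Qed.

(** Strictness rests on the spectrum being finite: the roots of the characteristic polynomial form a
    list, so moduli below 1 have a common bound [r < 1] and their supremum cannot reach 1. *)
Lemma spectral_radius_lt1P n (F : 'M[R]_n) :
  spectral_radius F < 1 <->
  forall z : C, eigenvalue (map_mx cplx F) z -> normc z < 1.
Proof.
have [rs rsE] : exists rs : seq C, forall z,
  eigenvalue (map_mx cplx F) z = (z \in rs).
  have [rs prs] := closed_field_poly_normal (char_poly (map_mx cplx F)).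
  exists rs => z; rewrite eigenvalue_root_char prs.
  by rewrite (monicP (char_poly_monic _)) scale1r root_prod_XsubC.
rewrite /spectral_radius.
set E := (X in sup X).
have ubE : ubound E (\sum_(z <- rs) normc z).
  move=> _ [z /= ez <-]; move: ez; rewrite rsE => zrs.
  rewrite (big_rem z)//= lerDl; apply: sumr_ge0 => *; exact: normc_ge0.
split=> [h z ez|h].
  by apply: le_lt_trans h; apply: ub_le_sup;
    [exists (\sum_(z <- rs) normc z)|exists z].
have [r [r0 r1 hr]] : exists r : R, [/\ 0 <= r, r < 1 & forall z,
  z \in rs -> normc z <= r].
  have {h} : forall z, z \in rs -> normc z < 1 by move=> z; rewrite -rsE;
    exact: h.
  elim: (rs) => [|z s IH] h; first by exists 0.
  have [r [r0 r1 hr]] : exists r : R, [/\ 0 <= r, r < 1 & forall z,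
    z \in s -> normc z <= r].
    by apply: IH => y ys; apply: h; rewrite inE ys orbT.
  exists (Num.max r (normc z)); split; first by rewrite le_max r0.
    by rewrite gt_max r1 h ?mem_head.
  move=> y; rewrite inE => /orP[/eqP->|/hr yr];
    first by rewrite le_max lexx orbT.
  by rewrite le_max yr.
have [E0|/set0P/negP/negPn/eqP ->] := pselect (E !=set0).
  apply: le_lt_trans r1; apply: ge_sup => // _ [z /= ez <-].
  by apply: hr; rewrite -rsE.
(* An empty spectrum, as for n = 0: the supremum is then 0. *)
by rewrite sup0.
Qed.

Lemma cvg_contraction (u e : nat -> R) (a : R) : 0 <= a < 1 ->
  (forall t, 0 <= u t) -> (forall t, u t.+1 <= a * u t + e t) ->
  e @ \oo --> 0 -> u @ \oo --> 0.
Proof.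
move=> /andP[a0 a1] u0 ue e0; apply/cvgrPdist_le => eps eps0.
have a1' : 0 < 1 - a by rewrite subr_gt0.
(* With errors of this size, eps / 2 is the fixed point of the recursion, so the induction below
   reproduces it exactly. *)
have d0 : 0 < eps / 2 * (1 - a) by rewrite mulr_gt0// divr_gt0.
move/cvgrPdist_le : e0 => /(_ _ d0)[N _ hN].
have bound k : u (N + k)%N <= a ^+ k * u N + eps / 2.
  elim: k => [|k IH].
    by rewrite addn0 expr0 mul1r lerDl ltW// divr_gt0.
  rewrite addnS; apply: le_trans (ue _) _.
  have ek : e (N + k)%N <= eps / 2 * (1 - a).
    apply: le_trans (ler_norm _) _.
    by have := hN (N + k)%N (leq_addr _ _); rewrite sub0r normrN.
  have := lerD (ler_wpM2l a0 IH) ek; rewrite exprS.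
  by move/le_trans; apply; rewrite le_eqVlt; apply/orP; left; apply/eqP; ring.
have ak : (fun k => a ^+ k * u N) @ \oo --> 0.
  rewrite -[0](mul0r (u N)); apply: cvgM; last exact: cvg_cst.
  by apply: cvg_expr; rewrite ger0_norm.
have eps2 : 0 < eps / 2 by rewrite divr_gt0.
move/cvgrPdist_le : ak => /(_ _ eps2)[K _ hK].
exists (N + K)%N => // t /= Kt.
have Nt : (N <= t)%N by apply: leq_trans Kt; exact: leq_addr.
rewrite sub0r normrN ger0_norm// -(subnKC Nt).
apply: le_trans (bound _) _; rewrite [leRHS](splitr eps) lerD2r.
apply: le_trans (ler_norm _) _; have := hK (t - N)%N; rewrite sub0r normrN.
by apply; rewrite /= leq_subRL.
Qed.

(* Strip one factor at a time: v' = (F - z) v is annihilated by the other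
   factors, and F^(t+1) v = z F^t v + F^t v'. *)
Lemma power_cvg0_annihilated n (F : 'M[C]_n.+1) (rs : seq C) :
  (forall z, z \in rs -> normc z < 1) ->
  forall v : 'M[C]_n.+1, horner_mx F (\prod_(z <- rs) ('X - z%:P)) *m v = 0 ->
  forall i j, (fun t => normc ((F ^+ t *m v) i j)) @ \oo --> 0.
Proof.
elim: rs => [|z rs IH] hrs v.
  rewrite big_nil rmorph1 mul1mx => -> i j.
  under eq_fun do rewrite mulmx0 mxE ComplexField.Normc.normc0.
  exact: cvg_cst.
rewrite big_cons mulrC rmorphM /= -mulmxA => hv i j.
set v' := horner_mx F ('X - z%:P) *m v in hv.
have /IH/(_ _ hv)/(_ i j) cv : forall z, z \in rs -> normc z < 1.
  by move=> y yrs; apply: hrs; rewrite inE yrs orbT.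
apply: (@cvg_contraction _ _ (normc z)) cv => [|t|t].
- by rewrite normc_ge0 hrs ?mem_head.
- exact: normc_ge0.
have Fv : F *m v = z *: v + v'.
  rewrite /v' rmorphB /= horner_mx_X horner_mx_C mulmxBl mul_scalar_mx.
  by rewrite addrC subrK.
rewrite exprSr -mulmxA Fv mulmxDr -scalemxAr mxE mxE -ComplexField.Normc.normcM.
exact: le_normcD.
Qed.

(** By Cayley-Hamilton the product of all factors X - z annihilates the identity matrix, so the
    preceding lemma applies with [v = 1]. *)
Lemma stable_power_cvg0 n (F : 'M[R]_n) : spectral_radius F < 1 ->
  (fun t => F ^+ t) @ \oo --> (0 : 'M[R]_n).
Proof.
case: n F => [|n] F; first by move=> _; apply/cvg_mxP => -[].
move=> /spectral_radius_lt1P h; apply/cvg_mxP => i j; rewrite mxE.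
have [rs prs] := closed_field_poly_normal (char_poly (map_mx cplx F)).
rewrite (monicP (char_poly_monic _)) scale1r in prs.
have hrs z : z \in rs -> normc z < 1.
  by move=> zrs; apply: h; rewrite eigenvalue_root_char prs root_prod_XsubC.
have := @power_cvg0_annihilated _ (map_mx cplx F) rs hrs 1.
rewrite -prs Cayley_Hamilton mul0mx => /(_ erefl i j) cv.
apply/norm_cvg0P; apply: cvg_trans cv; apply: near_eq_cvg.
apply: nearW => t; rewrite mulmx1 -rmorphXn /= mxE.
by rewrite /= expr0n addr0 sqrtr_sqr.
Qed.

End stability.

(** * Stein equations Y = D + G Y H and Lyapunov's criterion *)

Section stein.
Context {R : realType}.

Definition power_cvg0 n (F : 'M[R]_n) :=
  (fun t => F ^+ t) @ \oo --> (0 : 'M[R]_n).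

Lemma trmx_exp n (F : 'M[R]_n) t : (F ^+ t)^T = F^T ^+ t.
Proof.
elim: t => [|t IH]; first by rewrite !expr0 trmx1.
by rewrite exprS exprSr trmx_mul IH.
Qed.

Lemma power_cvg0_tr n (F : 'M[R]_n) : power_cvg0 F -> power_cvg0 F^T.
Proof.
move=> /cvg_trmx; rewrite trmx0; rewrite /power_cvg0.
by under eq_fun do rewrite trmx_exp.
Qed.

(** The map Y |-> Y - G Y H on vectorised matrices. Solving through its inverse rather than by a
    series reduces continuity in G and H to that of matrix inversion. *)
Definition stein_mx n (G H : 'M[R]_n) : 'M[R]_(n * n) :=
  1%:M - lin_mulmx G *m lin_mulmxr H.

(* The solution Y of Y = D + G Y H, when G and H have spectral radius < 1. *)
Definition stein n (G H D : 'M[R]_n) : 'M[R]_n :=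
  vec_mx (mxvec D *m invmx (stein_mx G H)).

Lemma mul_stein_mx n (G H Y : 'M[R]_n) :
  mxvec Y *m stein_mx G H = mxvec (Y - G *m Y *m H).
Proof.
by rewrite /stein_mx mulmxBr mulmx1 mulmxA !mul_vec_lin linearB.
Qed.

(** Iterating the equation gives Y = G^t Y H^t, which tends to 0. This injectivity yields existence
    too, the space being finite-dimensional. *)
Lemma stein_homogeneous n (G H Y : 'M[R]_n) : power_cvg0 G -> power_cvg0 H ->
  Y = G *m Y *m H -> Y = 0.
Proof.
move=> G0 H0 YE.
have Yt t : Y = G ^+ t *m Y *m H ^+ t.
  elim: t => [|t IH]; first by rewrite !expr0 mul1mx mulmx1.
  rewrite [in LHS]IH [in LHS]YE exprSr [in RHS]exprS.
  by rewrite !mulmxA.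
have c0 : (fun t => G ^+ t *m Y *m H ^+ t) @ \oo --> (0 *m Y *m 0 : 'M[R]_n).
  by apply: cvg_mulmx => //; apply: cvg_mulmx => //; exact: cvg_cst.
have c1 : (fun t => G ^+ t *m Y *m H ^+ t) @ \oo --> Y.
  by under eq_fun do rewrite -Yt; exact: cvg_cst.
by rewrite (cvg_unique _ c1 c0)// mulmx0.
Qed.

Lemma stein_mx_unit n (G H : 'M[R]_n) : power_cvg0 G -> power_cvg0 H ->
  stein_mx G H \in unitmx.
Proof.
move=> G0 H0; rewrite -row_free_unit; apply: inj_row_free => v.
rewrite -[v]vec_mxK mul_stein_mx => /eqP; rewrite mxvec_eq0 subr_eq0 => /eqP h.
by rewrite (stein_homogeneous G0 H0 h) linear0.
Qed.

Lemma steinP n (G H D Y : 'M[R]_n) : power_cvg0 G -> power_cvg0 H ->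
  Y = D + G *m Y *m H <-> Y = stein G H D.
Proof.
move=> G0 H0; have u := stein_mx_unit G0 H0; split=> [h|->].
  apply: (can_inj mxvecK); rewrite vec_mxK; apply: (canRL (mulmxK u)).
  by rewrite mul_stein_mx {1}h addrK.
apply/eqP; rewrite -subr_eq; apply/eqP/(can_inj mxvecK).
by rewrite -mul_stein_mx vec_mxK mulmxKV.
Qed.

Lemma stein_eq n (G H D : 'M[R]_n) : power_cvg0 G -> power_cvg0 H ->
  stein G H D = D + G *m stein G H D *m H.
Proof. by move=> G0 H0; apply/steinP. Qed.

Lemma stein_tr n (G H D : 'M[R]_n) : power_cvg0 G -> power_cvg0 H ->
  (stein G H D)^T = stein H^T G^T D^T.
Proof.
move=> G0 H0; apply/steinP; try exact: power_cvg0_tr.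
by rewrite {1}stein_eq// linearD /= !trmx_mul mulmxA.
Qed.

Lemma power_cvg0_sub1_unit n (F : 'M[R]_n) :
    power_cvg0 F -> 1%:M - F \in unitmx.
Proof.
move=> F0; rewrite -row_free_unit; apply: inj_row_free => v.
rewrite mulmxBr mulmx1 => /eqP; rewrite subr_eq0 => /eqP vF.
have vt t : v = v *m F ^+ t.
  elim: t => [|t IH]; first by rewrite expr0 mulmx1.
  by rewrite exprS -[F * _]/(F *m _) mulmxA -vF.
have c0 : (fun t => v *m F ^+ t) @ \oo --> (v *m 0 : 'rV[R]_n).
  by apply: cvg_mulmx => //; exact: cvg_cst.
have c1 : (fun t => v *m F ^+ t) @ \oo --> v.
  by under eq_fun do rewrite -vt; exact: cvg_cst.
by rewrite (cvg_unique _ c1 c0)// mulmx0.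
Qed.

(** The form of Y does not increase along x, F x, F^2 x, ... and tends to 0 there, so it was
    nonnegative at x. *)
Lemma stein_psd n (F D : 'M[R]_n) : power_cvg0 F -> psd D ->
  psd (stein F^T F D).
Proof.
move=> F0 [sD D0]; have Ft := power_cvg0_tr F0; split.
  by rewrite stein_tr// trmxK sD.
move=> x; set Y := stein _ _ _.
have YF y : qform Y (F *m y) <= qform Y y.
  by rewrite -qform_congr {2}/Y stein_eq// qform_addmx lerDr.
have Yt t : qform Y (F ^+ t *m x) <= qform Y x.
  elim: t => [|t IH]; first by rewrite expr0 mul1mx.
  by rewrite exprS -mulmxA; apply: le_trans (YF _) IH.
have c : (fun t => qform Y (F ^+ t *m x)) @ \oo --> qform Y (0 *m x).
  by apply: cvg_qform; apply: cvg_mulmx => //; exact: cvg_cst.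
have -> : 0 = qform Y (0 *m x) by rewrite mul0mx /qform inner0l.
rewrite -(cvg_lim _ c)//; apply: limr_le; first by apply/cvg_ex; eexists;
  exact: c.
exact: nearW.
Qed.

Section limits.
Context {T : Type} {E : set_system T} {FE : Filter E}.

Lemma cvg_stein n (G H D : T -> 'M[R]_n) (G0 H0 D0 : 'M[R]_n) :
  stein_mx G0 H0 \in unitmx ->
  G @ E --> G0 -> H @ E --> H0 -> D @ E --> D0 ->
  (fun t => stein (G t) (H t) (D t)) @ E --> stein G0 H0 D0.
Proof.
move=> u cG cH cD; rewrite /stein.
apply: (@cvg_linear _ _ _ _ _ _ _ _ (@vec_mx R n n)).
apply: cvg_mulmx; first exact: (@cvg_linear _ _ _ _ _ _ _ _ (@mxvec R n n)).
apply: cvg_invmx => //; apply: cvgB; first exact: cvg_cst.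
apply: cvg_mulmx; last exact: (@cvg_linear _ _ _ _ _ _ _ _ (@lin_mulmxr R n n
  n)).
apply/cvg_mxP => i j; case/mxvec_indexP: i => i1 i2;
  case/mxvec_indexP: j => j1 j2.
have lE (M : 'M[R]_n) : lin_mulmx M (mxvec_index i1 i2) (mxvec_index j1 j2)
    = (M *m delta_mx i1 i2) j1 j2.
  by rewrite /lin_mulmx /lin_mx mxE /= -mxvec_delta mxvecK mxvecE.
rewrite lE; under eq_fun do rewrite lE.
have : (fun t => G t *m delta_mx i1 i2) @ E --> G0 *m delta_mx i1 i2.
  by apply: cvg_mulmx => //; exact: cvg_cst.
by move/cvg_mxP; apply.
Qed.

End limits.

Local Notation cplx := (real_complex R).
Local Notation C := (R[i])%C.

(** [eigenvalue] provides a row eigenvector; invariance of the determinant under transposition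
    provides a column one, split here into real and imaginary parts. *)
Lemma eigenvalue_col n (F : 'M[R]_n) (z : C) : eigenvalue (map_mx cplx F) z ->
  exists a b : 'cV[R]_n, [/\ (a != 0) || (b != 0),
    F *m a = complex.Re z *: a - complex.Im z *: b &
    F *m b = complex.Im z *: a + complex.Re z *: b].
Proof.
move=> /eigenvalueP[v vF v0].
have : \det (z%:M - map_mx cplx F) == 0.
  by apply/det0P; exists v => //; rewrite mulmxBr mul_mx_scalar vF subrr.
rewrite -det_tr => /det0P[u u0 /(congr1 trmx)].
rewrite trmx_mul trmxK trmx0 mulmxBl mul_scalar_mx => /eqP.
rewrite subr_eq0 eq_sym => /eqP uF.
have ReM (x : R) (y : C) : complex.Re (cplx x * y) = x * complex.Re y.
  by case: y => y1 y2 /=; rewrite mul0r subr0.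
have ImM (x : R) (y : C) : complex.Im (cplx x * y) = x * complex.Im y.
  by case: y => y1 y2 /=; rewrite mul0r addr0.
exists (map_mx (@complex.Re R) u^T), (map_mx (@complex.Im R) u^T); split.
- apply: contraR u0; rewrite negb_or !negbK => /andP[/eqP a0 /eqP b0].
  apply/eqP/rowP => i; rewrite mxE; apply/eqP; rewrite eq_complex /=.
  have := congr1 (fun M : 'cV[R]_n => M i 0) a0; rewrite !mxE => ->.
  have := congr1 (fun M : 'cV[R]_n => M i 0) b0; rewrite !mxE => ->.
  by rewrite eqxx.
- apply/colP => i; have := congr1 (fun M : 'cV[C]_n => complex.Re (M i 0)) uF.
  rewrite !mxE raddf_sum /= => h.
  rewrite -[RHS](_ : complex.Re (z * u 0 i) = _);
    last by case: (z) (u 0 i) => ? ? [].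
  by rewrite -h; apply: eq_bigr => j _; rewrite !mxE ReM.
- apply/colP => i; have := congr1 (fun M : 'cV[C]_n => complex.Im (M i 0)) uF.
  rewrite !mxE raddf_sum /= => h.
  rewrite -[RHS](_ : complex.Im (z * u 0 i) = _); last first.
    by case: (z) (u 0 i) => ? ? [? ?] /=; rewrite addrC.
  by rewrite -h; apply: eq_bigr => j _; rewrite !mxE ImM.
Qed.

(* A complex eigenvector a + i b for p + i q is handled through the real pair
   (a, b); the last hypothesis is the Hautus test for detectability of (F,
     D). *)
Lemma lyapunov_stable n (F P D : 'M[R]_n) : psd P -> psd D ->
  P = D + F^T *m P *m F ->
  (forall (a b : 'cV[R]_n) (p q : R), 1 <= p ^+ 2 + q ^+ 2 ->
     F *m a = p *: a - q *: b -> F *m b = q *: a + p *: b ->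
     D *m a = 0 -> D *m b = 0 -> a = 0 /\ b = 0) ->
  spectral_radius F < 1.
Proof.
move=> P0 D0 PE h; apply/spectral_radius_lt1P => z /eigenvalue_col[a [b [ab Fa
  Fb]]].
set p := complex.Re z in Fa Fb; set q := complex.Im z in Fa Fb.
rewrite ltNge; apply/negP => z1.
have pq : 1 <= p ^+ 2 + q ^+ 2.
  rewrite /p /q; case: (z) z1 => x y /= xy.
  have -> : x ^+ 2 + y ^+ 2 = Num.sqrt (x ^+ 2 + y ^+ 2) ^+ 2.
    by rewrite sqr_sqrtr// addr_ge0// sqr_ge0.
  by rewrite exprn_ege1.
have PF x : qform P x = qform D x + qform P (F *m x).
  by rewrite {1}PE qform_addmx qform_congr.
(* The cross terms in p q have opposite signs and cancel, leaving |z|^2. *)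
have e1 : qform P (F *m a) + qform P (F *m b)
    = (p ^+ 2 + q ^+ 2) * (qform P a + qform P b).
  rewrite Fa Fb -scaleNr !qformD ?(P0.1)//
    !qformZ -!scalemxAr !innerZl !innerZr.
  by rewrite sqrrN; ring.
have Pab : 0 <= qform P a + qform P b by rewrite addr_ge0// P0.2.
have : qform D a + qform D b <= 0.
  have e2 : (qform P a + qform P b) <= (p ^+ 2 + q ^+ 2) * (qform P a + qform P
    b).
    by rewrite ler_peMl.
  by have := PF a; have := PF b; lra.
have Da := D0.2 a; have Db := D0.2 b => Dab.
have [a0 b0] : a = 0 /\ b = 0.
  by apply: (h a b p q) => //; apply: psd_qform_eq0 => //; lra.
by move: ab; rewrite a0 b0 eqxx.
Qed.

End stein.

(** * Expectations and second moments *)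

Section scalar_expectation.
Context {R : realType} {d : measure_display} {T : measurableType d}.
Variable P : probability T R.
Implicit Types f g : T -> R.

Definition L1 f := P.-integrable [set: T] (EFin \o f).
Definition L2 f := measurable_fun [set: T] f /\ L1 (fun o => f o ^+ 2).
Definition Ex f : R := fine 'E_P[f].

Lemma ExE f : L1 f -> ('E_P[f] = (Ex f)%:E)%E.
Proof. by move=> f1; rewrite /Ex fineK// unlock integrable_fin_num. Qed.

Lemma L1_dom f g : measurable_fun [set: T] f ->
  (forall o, `|f o| <= g o) -> L1 g -> L1 f.
Proof.
move=> mf fg g1; apply: le_integrable g1 => //; first exact/measurable_EFinP.
by move=> o _ /=; rewrite lee_fin; apply: le_trans (fg o) (ler_norm _).
Qed.

Lemma L1D f g : L1 f -> L1 g -> L1 (fun o => f o + g o).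
Proof. by move=> f1 g1; exact: (integrableD measurableT f1 g1). Qed.

Lemma L1Z a f : L1 f -> L1 (fun o => a * f o).
Proof. by move=> f1; exact: (integrableZl measurableT a f1). Qed.

Lemma L1_cst c : L1 (fun=> c).
Proof. exact: finite_measure_integrable_cst. Qed.

Lemma L1_sum I (r : seq I) (F : I -> T -> R) :
  (forall i, L1 (F i)) -> L1 (fun o => \sum_(i <- r) F i o).
Proof.
move=> F1; elim: r => [|i r IH].
  by under eq_fun do rewrite big_nil; exact: L1_cst.
by under eq_fun do rewrite big_cons; exact: L1D.
Qed.

Lemma ExD f g : L1 f -> L1 g -> Ex (fun o => f o + g o) = Ex f + Ex g.
Proof.
move=> f1 g1; rewrite {1}/Ex.
have -> : ('E_P[fun o => (f o + g o)%R] = 'E_P[f] + 'E_P[g])%E.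
  by rewrite unlock; exact: (integralD_EFin measurableT f1 g1).
by rewrite !ExE.
Qed.

Lemma ExZ a f : L1 f -> Ex (fun o => a * f o) = a * Ex f.
Proof.
move=> f1; rewrite {1}/Ex.
have -> : ('E_P[fun o => (a * f o)%R] = a%:E * 'E_P[f])%E.
  by rewrite unlock; under eq_integral do rewrite EFinM; rewrite integralZl.
by rewrite ExE.
Qed.

Lemma Ex_cst c : Ex (fun=> c) = c.
Proof. by rewrite /Ex expectation_cst. Qed.

Lemma Ex_sum I (r : seq I) (F : I -> T -> R) : (forall i, L1 (F i)) ->
  Ex (fun o => \sum_(i <- r) F i o) = \sum_(i <- r) Ex (F i).
Proof.
move=> F1; elim: r => [|i r IH].
  by rewrite big_nil; under eq_fun do rewrite big_nil; exact: Ex_cst.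
rewrite big_cons; under eq_fun do rewrite big_cons.
by rewrite ExD ?IH//; exact: L1_sum.
Qed.

Lemma Ex_ge0 f : (forall o, 0 <= f o) -> 0 <= Ex f.
Proof. by move=> f0; rewrite /Ex fine_ge0// expectation_ge0. Qed.

Lemma Ex_le f g : L1 f -> L1 g -> (forall o, f o <= g o) -> Ex f <= Ex g.
Proof.
move=> f1 g1 fg; rewrite -subr_ge0.
have -> : Ex g - Ex f = Ex (fun o => g o + (-1) * f o).
  by rewrite ExD ?ExZ ?mulN1r//; exact: L1Z.
by apply: Ex_ge0 => o; rewrite mulN1r subr_ge0.
Qed.

Lemma L2_mul f g : L2 f -> L2 g -> L1 (fun o => f o * g o).
Proof.
move=> [mf f2] [mg g2]; apply: L1_dom (L1D f2 g2); first exact: measurable_funM.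
move=> o; rewrite ler_norml; apply/andP; split.
  have := sqr_ge0 (f o + g o); have := sqr_ge0 (f o); have := sqr_ge0 (g o).
  by rewrite sqrrD; lra.
have := sqr_ge0 (f o - g o); have := sqr_ge0 (f o); have := sqr_ge0 (g o).
by rewrite sqrrB; lra.
Qed.

(** A crude form of Cauchy-Schwarz, from |f g| <= f^2 + g^2, sufficient to keep cross moments
    bounded. *)
Lemma Ex_mul_le f g : L2 f -> L2 g ->
  `|Ex (fun o => f o * g o)| <= Ex (fun o => f o ^+ 2) + Ex (fun o => g o ^+ 2).
Proof.
move=> f2 g2; rewrite -ExD; [|exact: f2.2|exact: g2.2].
have h1 := L1D f2.2 g2.2; have h2 := L2_mul f2 g2.
rewrite ler_norml; apply/andP; split; last first.
  apply: Ex_le => // o; have := sqr_ge0 (f o - g o).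
  have := sqr_ge0 (f o); have := sqr_ge0 (g o); rewrite sqrrB; lra.
rewrite lerNl -mulN1r -ExZ//; apply: Ex_le => //; first exact: L1Z.
move=> o; have := sqr_ge0 (f o + g o).
have := sqr_ge0 (f o); have := sqr_ge0 (g o); rewrite sqrrD; lra.
Qed.

Lemma L2_cst c : L2 (fun=> c).
Proof. by split; [exact: measurable_cst|exact: L1_cst]. Qed.

Lemma L2D f g : L2 f -> L2 g -> L2 (fun o => f o + g o).
Proof.
move=> f2 g2; split; first exact: (measurable_funD f2.1 g2.1).
under eq_fun do rewrite sqrrD -mulr_natl.
apply: L1D g2.2; apply: L1D f2.2 _.
exact/L1Z/L2_mul.
Qed.

Lemma L2Z a f : L2 f -> L2 (fun o => a * f o).
Proof.
move=> f2; split; first exact: measurable_funM (measurable_cst _) f2.1.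
by under eq_fun do rewrite exprMn; exact: L1Z f2.2.
Qed.

Lemma L2_L1 f : L2 f -> L1 f.
Proof.
by move=> f2; have := L2_mul f2 (L2_cst 1); under eq_fun do rewrite mulr1.
Qed.

Lemma L2_sum I (r : seq I) (F : I -> T -> R) :
  (forall i, L2 (F i)) -> L2 (fun o => \sum_(i <- r) F i o).
Proof.
move=> F1; elim: r => [|i r IH].
  by under eq_fun do rewrite big_nil; exact: L2_cst.
by under eq_fun do rewrite big_cons; exact: L2D.
Qed.

(* The joint law is the product law, so Fubini applies. *)
Lemma Ex_mul_indep (X Y : {RV P >-> R}) :
  (forall A B, measurable A -> measurable B ->
     P (X @^-1` A `&` Y @^-1` B) = (P (X @^-1` A) * P (Y @^-1` B))%E) ->
  L1 X -> L1 Y -> L1 (fun o => X o * Y o) ->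
  Ex (fun o => X o * Y o) = Ex X * Ex Y.
Proof.
move=> indep X1 Y1 XY1.
have mXY : measurable_fun [set: T] (fun o => (X o,
  Y o)) by exact: measurable_fun_pair.
pose Z : {mfun T >-> (R * R)%type} := mfun_Sub (mem_set mXY).
pose f (z : R * R) : \bar R := (z.1 * z.2)%:E.
have mf : measurable_fun [set: R * R] f.
  by apply/measurable_EFinP; apply: measurable_funM.
have same A : measurable A ->
  (distribution P X \x distribution P Y)%E A = distribution P Z A.
  by move=> mA; apply: product_measure_unique => // B C mB mC; rewrite -indep.
have fZ : (distribution P X \x distribution P Y)%E.-integrable setT f.
  apply/integrableP; split=> //.
  rewrite (eq_measure_integral (distribution P Z)); last by move=> A mA _;
    exact: same.
  have /integrableP[_] : (distribution P Z).-integrable setT f.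
    by apply: integrable_pushforward => //; rewrite preimage_setT.
  by [].
have : ('E_P[fun o => (X o * Y o)%R] = 'E_P[X] * 'E_P[Y])%E.
  rewrite [in LHS]unlock.
  transitivity (\int[distribution P Z]_z f z)%E.
    by rewrite integral_distribution.
  rewrite (eq_measure_integral (distribution P X \x distribution P Y)%E);
    last by move=> A mA _; exact/esym/same.
  rewrite -integral12_prod_meas1// /fubini_F /f /=.
  have inY : (distribution P Y).-integrable setT (EFin : R -> \bar R).
    by apply: integrable_pushforward => //; rewrite preimage_setT.
  have inX : (distribution P X).-integrable setT (EFin : R -> \bar R).
    by apply: integrable_pushforward => //; rewrite preimage_setT.
  under eq_integral => x _.
    under eq_integral do rewrite EFinM.
    rewrite integralZl//.
    over.
  rewrite /= (integral_distribution (f := EFin))// unlock.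
  have -> : (\int[P]_x (EFin \o Y) x = (Ex Y)%:E)%E by rewrite -ExE// unlock.
  by rewrite integralZr// (integral_distribution (f := EFin)).
by rewrite /Ex => ->; rewrite !ExE.
Qed.

End scalar_expectation.

Section random_vectors.
Context {R : realType} {d : measure_display} {T : measurableType d}.
Variable P : probability T R.

Local Notation gen n := (g_sigma_algebraType (@open 'cV[R]_n)).

Lemma measurable_coord n (i : 'I_n) :
  measurable_fun [set: gen n] (fun v : gen n => (v : 'cV[R]_n) i 0 : R).
Proof.
apply: (measurability _ (RGenOpens.measurableE R)).
move=> _ [_ [a [b ->] <-]]; rewrite setTI.
apply: sub_gen_smallest; apply: open_comp; last exact: interval_open.
by move=> x _; exact: coord_continuous.
Qed.

Lemma random_vector_coord n (x : T -> 'cV[R]_n) i : random_vector x ->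
  measurable_fun [set: T] (fun o => x o i 0).
Proof. by move=> mx; exact: (measurableT_comp (measurable_coord i) mx). Qed.

Lemma L1_ge0 (f : T -> R) : measurable_fun [set: T] f -> (forall o, 0 <= f o) ->
  ('E_P[f] < +oo)%E -> L1 P f.
Proof.
move=> mf f0 Ef; apply/integrableP; split; first exact/measurable_EFinP.
move: Ef; rewrite unlock; congr (_ < _)%E; apply: eq_integral => o _.
by rewrite /= ger0_norm.
Qed.

Definition L2v n (x : T -> 'cV[R]_n) := forall i, L2 P (fun o => x o i 0).

(** Applied with k = 2 to the noise and k = 1 to the initial state; a squared coordinate is at most
    |x|^2 <= 1 + |x|^(2k). *)
Lemma finite_moment_L2v n k (x : T -> 'cV[R]_n) : (0 < k)%N ->
  random_vector x -> finite_moment P (k * 2) x -> L2v x.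
Proof.
move=> k0 rx fx i; split; first exact: random_vector_coord.
have mI : measurable_fun [set: T] (fun o => inner (x o) (x o)).
  under eq_fun do rewrite innerE; apply: measurable_sum => j.
  by apply: measurable_funM; exact: random_vector_coord.
have nE o : norm2 (x o) ^+ (k * 2) = inner (x o) (x o) ^+ k.
  by rewrite mulnC exprM norm2_sqr.
have fk : L1 P (fun o => inner (x o) (x o) ^+ k).
  apply: L1_ge0; first exact: measurable_funX.
    by move=> o; rewrite exprn_ge0 ?inner_ge0.
  by move: fx; rewrite /finite_moment; under eq_fun do rewrite nE.
apply: L1_dom (L1D (L1_cst P 1) fk).
  by apply: measurable_funX; exact: random_vector_coord.
move=> o; rewrite ger0_norm ?sqr_ge0//.
apply: le_trans (inner_coord_le _ _) _.
have I0 := inner_ge0 (x o); have [I1|/ltW I1] := leP (inner (x o) (x o)) 1.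
  by apply: le_trans I1 _; rewrite lerDl exprn_ge0.
by apply: le_trans (_ : _ <= inner (x o) (x o) ^+ k) _;
  [rewrite ler_eXnr|rewrite lerDr].
Qed.

Lemma Ex_identically_distributed n (w : nat -> T -> 'cV[R]_n) s t
    (phi : gen n -> R) :
  (forall t, random_vector (w t)) -> identically_distributed P w ->
  measurable_fun [set: gen n] phi ->
  L1 P (fun o => phi (w s o)) -> L1 P (fun o => phi (w t o)) ->
  Ex P (fun o => phi (w s o)) = Ex P (fun o => phi (w t o)).
Proof.
move=> rw idw mphi s1 t1.
pose W r : {mfun T >-> gen n} := mfun_Sub (mem_set (rw r)).
have EW r : L1 P (fun o => phi (w r o)) ->
    ('E_P[fun o => phi (w r o)] = \int[distribution P (W r)]_v (phi v)%:E)%E.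
  move=> r1; rewrite unlock integral_distribution//.
  exact/measurable_EFinP.
rewrite /Ex !EW//; congr fine; apply: eq_measure_integral => A mA _.
exact: idw.
Qed.

Lemma Ex_mul_iid n (w : nat -> T -> 'cV[R]_n) s t i j : s != t ->
  iid P w -> (forall t, L2v (w t)) ->
  Ex P (fun o => w s o i 0 * w t o j 0)
    = Ex P (fun o => w s o i 0) * Ex P (fun o => w t o j 0).
Proof.
move=> st [rw indep _] w2.
pose X : {mfun T >-> R} := mfun_Sub (mem_set (random_vector_coord i (rw s))).
pose Y : {mfun T >-> R} := mfun_Sub (mem_set (random_vector_coord j (rw t))).
apply: (@Ex_mul_indep _ _ _ P X Y); last 3 first.
- exact/L2_L1/w2.
- exact/L2_L1/w2.
- by apply: L2_mul; exact: w2.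
move=> A B mA mB.
pose E r : set 'cV[R]_n := if r == s then [set v | A (v i 0)] else [set v | B
  (v j 0)].
have bA : borel [set v : 'cV[R]_n | A (v i 0)].
  by have := measurable_coord i measurableT mA; rewrite setTI.
have bB : borel [set v : 'cV[R]_n | B (v j 0)].
  by have := measurable_coord j measurableT mB; rewrite setTI.
have := indep [fset s; t]%fset E.
rewrite big_fsetU1 ?inE//= big_seq_fset1 /E eqxx eq_sym (negbTE st) => <-;
  last first.
  by move=> r; case: ifP.
congr (P _); apply/seteqP; split=> o /=.
  move=> [Xo Yo] r /=; rewrite !inE => /orP[]/eqP-> /=.
    by rewrite eqxx.
  by rewrite eq_sym (negbTE st).
move=> h; split.
  by have := h s; rewrite /= eqxx; apply; rewrite !inE eqxx.
by have := h t; rewrite /= eq_sym (negbTE st); apply; rewrite !inE eqxx orbT.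
Qed.

Definition L1mx p q (X : T ->
    'M[R]_(p, q)) := forall i j, L1 P (fun o => X o i j).

Lemma mean_mxD p q (X Y : T -> 'M[R]_(p, q)) : L1mx X -> L1mx Y ->
  mean_mx P (fun o => X o + Y o) = mean_mx P X + mean_mx P Y.
Proof.
move=> X1 Y1; apply/matrixP => i j; rewrite !mxE -/(Ex P _).
by under eq_fun do rewrite mxE; rewrite ExD.
Qed.

Lemma mean_mx_mull p q r (A : 'M[R]_(p, q)) (X : T -> 'M[R]_(q, r)) : L1mx X ->
  mean_mx P (fun o => A *m X o) = A *m mean_mx P X.
Proof.
move=> X1; apply/matrixP => i j; rewrite !mxE -/(Ex P _).
under eq_fun do rewrite mxE.
rewrite Ex_sum; last by move=> k; exact: L1Z.
by apply: eq_bigr => k _; rewrite ExZ// mxE.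
Qed.

Lemma mean_mx_tr p q (X : T -> 'M[R]_(p, q)) :
  mean_mx P (fun o => (X o)^T) = (mean_mx P X)^T.
Proof. by apply/matrixP => i j; rewrite !mxE; under eq_fun do rewrite mxE. Qed.

Lemma mean_mx_cst p q (M : 'M[R]_(p, q)) : mean_mx P (fun=> M) = M.
Proof. by apply/matrixP => i j; rewrite !mxE -/(Ex P _) Ex_cst. Qed.

Lemma L2v_cst n (c : 'cV[R]_n) : L2v (fun=> c).
Proof. by move=> i; exact: L2_cst. Qed.

Lemma L2vD n (x y : T -> 'cV[R]_n) : L2v x -> L2v y -> L2v (fun o => x o + y o).
Proof. by move=> x2 y2 i; under eq_fun do rewrite mxE; exact: L2D. Qed.

Lemma L2v_mulmx n p (A : 'M[R]_(p, n)) (x : T -> 'cV[R]_n) :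
  L2v x -> L2v (fun o => A *m x o).
Proof.
move=> x2 i; under eq_fun do rewrite mxE.
by apply: L2_sum => k; exact: L2Z.
Qed.

Lemma L2v_L1mx n (x : T -> 'cV[R]_n) : L2v x -> L1mx x.
Proof. by move=> x2 i j; rewrite ord1; exact/L2_L1/x2. Qed.

Definition cross_moment n p (x : T -> 'cV[R]_n) (y : T -> 'cV[R]_p) :
    'M[R]_(n, p) :=
  mean_mx P (fun o => x o *m (y o)^T).

Lemma cross_momentE n p (x : T -> 'cV[R]_n) (y : T -> 'cV[R]_p) i j :
  cross_moment x y i j = Ex P (fun o => x o i 0 * y o j 0).
Proof.
by rewrite mxE -/(Ex P _); under eq_fun do rewrite mxE big_ord1 mxE.
Qed.

Lemma L1mx_cross n p (x : T -> 'cV[R]_n) (y : T -> 'cV[R]_p) :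
  L2v x -> L2v y -> L1mx (fun o => x o *m (y o)^T).
Proof.
move=> x2 y2 i j; under eq_fun do rewrite mxE big_ord1 mxE.
exact: L2_mul.
Qed.

Lemma cross_moment_tr n p (x : T -> 'cV[R]_n) (y : T -> 'cV[R]_p) :
  (cross_moment x y)^T = cross_moment y x.
Proof.
rewrite /cross_moment -mean_mx_tr.
by under eq_fun do rewrite trmx_mul trmxK.
Qed.

Lemma cross_momentDl n p (x y : T -> 'cV[R]_n) (z : T -> 'cV[R]_p) :
  L2v x -> L2v y -> L2v z ->
  cross_moment (fun o => x o + y o) z = cross_moment x z + cross_moment y z.
Proof.
move=> x2 y2 z2; rewrite /cross_moment; under eq_fun do rewrite mulmxDl.
by rewrite mean_mxD//; exact: L1mx_cross.
Qed.

Lemma cross_momentDr n p (z : T -> 'cV[R]_n) (x y : T -> 'cV[R]_p) :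
  L2v x -> L2v y -> L2v z ->
  cross_moment z (fun o => x o + y o) = cross_moment z x + cross_moment z y.
Proof.
move=> x2 y2 z2; rewrite -[LHS]trmxK cross_moment_tr cross_momentDl//.
by rewrite linearD /= !cross_moment_tr.
Qed.

Lemma cross_moment_mull n p q (A : 'M[R]_(q, n)) (x : T -> 'cV[R]_n)
    (z : T -> 'cV[R]_p) : L2v x -> L2v z ->
  cross_moment (fun o => A *m x o) z = A *m cross_moment x z.
Proof.
move=> x2 z2; rewrite /cross_moment; under eq_fun do rewrite -mulmxA.
by rewrite mean_mx_mull//; exact: L1mx_cross.
Qed.

Lemma cross_moment_mulr n p q (A : 'M[R]_(q, n)) (x : T -> 'cV[R]_n)
    (z : T -> 'cV[R]_p) : L2v x -> L2v z ->
  cross_moment z (fun o => A *m x o) = cross_moment z x *m A^T.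
Proof.
move=> x2 z2; rewrite -[LHS]trmxK cross_moment_tr cross_moment_mull//.
by rewrite trmx_mul cross_moment_tr.
Qed.

Lemma cross_moment_cstr n p (x : T -> 'cV[R]_n) (c : 'cV[R]_p) : L2v x ->
  cross_moment x (fun=> c) = mean_mx P x *m c^T.
Proof.
move=> x2; rewrite -[LHS]trmxK cross_moment_tr /cross_moment.
rewrite mean_mx_mull; last by move=> i j; under eq_fun do rewrite mxE;
  exact: L2v_L1mx.
by rewrite mean_mx_tr trmx_mul trmxK.
Qed.

Lemma mean_mxtrace n p (M : 'M[R]_(p, n)) (x : T -> 'cV[R]_n) (y : T ->
    'cV[R]_p) :
  L2v x -> L2v y ->
  L1 P (fun o => \tr (M *m (x o *m (y o)^T))) /\
  Ex P (fun o => \tr (M *m (x o *m (y o)^T))) = \tr (M *m cross_moment x y).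
Proof.
move=> x2 y2; have xy := L1mx_cross x2 y2; split.
  rewrite /mxtrace; apply: L1_sum => i; under eq_fun do rewrite mxE.
  by apply: L1_sum => k; exact: L1Z.
rewrite /cross_moment -mean_mx_mull// /mxtrace Ex_sum.
  by apply: eq_bigr => i _; rewrite mxE.
move=> i; under eq_fun do rewrite mxE.
by apply: L1_sum => k; exact: L1Z.
Qed.

End random_vectors.

(** * Stationary moments and the ergodic cost *)

Section stationary.
Context {R : realType} {n m : nat}.
Variables (A : 'M[R]_n) (B : 'M[R]_(n, m)) (wbar : 'cV[R]_n) (W : 'M[R]_n).
Variable X : 'M[R]_(m, n + 1).
Local Notation F := (closed_loop A B X).
Hypothesis F0 : power_cvg0 F.

Lemma stat_meanE :
  stat_mean A B wbar X = invmx (1%:M - F) *m (B *m offset X + wbar).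
Proof.
have u := power_cvg0_sub1_unit F0.
have sol (x : 'cV[R]_n) : x = F *m x + B *m offset X + wbar <->
    x = invmx (1%:M - F) *m (B *m offset X + wbar).
  split=> [h|->].
    apply: (canRL (mulKmx u)); rewrite mulmxBl mul1mx; apply/eqP;
      rewrite subr_eq addrC addrA.
    by rewrite -h.
  set y := _ *m _; have : (1%:M - F) *m y = B *m offset X + wbar by rewrite
    mulKVmx.
  by rewrite mulmxBl mul1mx -addrA => <-; rewrite addrC subrK.
apply: get_unique; first by apply/sol.
by move=> y /sol.
Qed.

Lemma stat_mean_eq (x := stat_mean A B wbar X) :
  x = F *m x + B *m offset X + wbar.
Proof.
have u := power_cvg0_sub1_unit F0.
have : (1%:M - F) *m x = B *m offset X + wbar by rewrite /x stat_meanE mulKVmx.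
by rewrite mulmxBl mul1mx -addrA => <-; rewrite addrC subrK.
Qed.

Lemma stat_covE : stat_cov A B W X = stein F F^T W.
Proof.
have Ft := power_cvg0_tr F0.
by apply: get_unique => [|Y] /=; [exact: stein_eq|move/(steinP _ _ F0 Ft)].
Qed.

Lemma stat_cov_eq (Sg := stat_cov A B W X) : Sg = W + F *m Sg *m F^T.
Proof. by rewrite /Sg stat_covE; apply: stein_eq => //;
  exact: power_cvg0_tr. Qed.

End stationary.

Section lagrangian_limit.
Context {R : realType} {n m : nat} {d : measure_display} {T : measurableType d}.
Variables (P : probability T R) (A : 'M[R]_n) (B : 'M[R]_(n, m)).
Variables (w : nat -> T -> 'cV[R]_n) (x0 : T -> 'cV[R]_n).
Hypotheses (w_iid : iid P w) (w_L2 : forall t, L2v P (w t)) (x0_L2 : L2v P x0).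

Local Notation wbar := (noise_mean P w).
Local Notation W := (noise_cov P w).
Local Notation omega t := (fun o => w t o + - wbar).

Lemma noise_L2 t : L2v P (omega t).
Proof. by apply: L2vD => //; exact: L2v_cst. Qed.

Lemma mean_iid t : mean_mx P (w t) = wbar.
Proof.
case: w_iid => rw _ idw; apply/colP => i; rewrite !mxE.
apply: (@Ex_identically_distributed _ _ _ P n w t 0%N (fun v => v i 0)) => //.
- exact: measurable_coord.
- exact/L2_L1/w_L2.
- exact/L2_L1/w_L2.
Qed.

Lemma mean_noise t : mean_mx P (omega t) = 0.
Proof.
rewrite mean_mxD; [|exact: L2v_L1mx|exact/L2v_L1mx/L2v_cst].
by rewrite mean_mx_cst mean_iid subrr.
Qed.

Lemma cross_moment_noise s t :
  cross_moment P (omega s) (omega t) = if s == t then W else 0.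
Proof.
case: ifP => [/eqP<-|/negbT st].
  case: w_iid => rw _ idw; apply/matrixP => i j; rewrite cross_momentE.
  have -> : W i j = Ex P (fun o => (omega 0%N) o i 0 * (omega 0%N) o j 0).
    exact: cross_momentE.
  apply: (@Ex_identically_distributed _ _ _ P n w s 0%N
    (fun v => (v + - wbar) i 0 * (v + - wbar) j 0)) => //.
  - have mc k : measurable_fun [set: g_sigma_algebraType (@open 'cV[R]_n)]
        (fun v : g_sigma_algebraType (@open 'cV[R]_n) => ((v : 'cV[R]_n) + -
          wbar) k 0).
      under eq_fun do rewrite mxE.
      by apply: measurable_funD;
        [exact: measurable_coord|exact: measurable_cst].
    by apply: measurable_funM; exact: mc.
  - by apply: L2_mul; exact: noise_L2.
  - by apply: L2_mul; exact: noise_L2.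
rewrite cross_momentDl//; [|exact: L2v_cst|exact: noise_L2].
rewrite -[X in _ + X]trmxK cross_moment_tr cross_moment_cstr;
  last exact: noise_L2.
rewrite mean_noise mul0mx trmx0 addr0 cross_momentDr//; last exact: L2v_cst.
rewrite cross_moment_cstr// mean_iid linearN /= mulmxN.
apply/eqP; rewrite subr_eq0; apply/eqP/matrixP => i j.
have Ew r k : Ex P (fun o => w r o k 0) = wbar k 0 by rewrite -(mean_iid r) mxE.
by rewrite cross_momentE Ex_mul_iid//
  !Ew [(wbar *m _) _ _]mxE big_ord1 [wbar^T _ _]mxE.
Qed.

Variable X : 'M[R]_(m, n + 1).
Local Notation F := (closed_loop A B X).
Hypothesis F0 : power_cvg0 F.
Local Notation xbar := (stat_mean A B wbar X).
Local Notation Sg := (stat_cov A B W X).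

(* The centred part of the state driven by the noise: unlike the state itself
   it is uncorrelated with the future noise whatever the initial state. *)
Fixpoint noise_response t o : 'cV[R]_n :=
  if t is s.+1 then F *m noise_response s o + (w s o + - wbar) else 0.
Local Notation y := noise_response.

Lemma noise_response_L2 t : L2v P (y t).
Proof.
elim: t => [|t IH]; first exact: L2v_cst.
by apply: L2vD; [exact: L2v_mulmx|exact: noise_L2].
Qed.

Lemma mean_noise_response t : mean_mx P (y t) = 0.
Proof.
elim: t => [|t IH]; first exact: mean_mx_cst.
rewrite mean_mxD; last 2 first.
- exact/L2v_L1mx/L2v_mulmx/noise_response_L2.
- exact/L2v_L1mx/noise_L2.
rewrite mean_noise mean_mx_mull ?IH ?mulmx0 ?addr0//.
exact/L2v_L1mx/noise_response_L2.
Qed.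

(** The response at time t involves only the noises of index below t, so r = t is allowed. *)
Lemma cross_moment_response_noise t r : (t <= r)%N ->
  cross_moment P (y t) (omega r) = 0.
Proof.
elim: t => [|t IH] tr.
  rewrite -[LHS]trmxK cross_moment_tr cross_moment_cstr; last exact: noise_L2.
  by rewrite trmx0 mulmx0 trmx0.
rewrite cross_momentDl; try exact: noise_L2;
  last exact/L2v_mulmx/noise_response_L2.
rewrite cross_moment_mull; [|exact: noise_response_L2|exact: noise_L2].
by rewrite IH ?(ltnW tr)// mulmx0 add0r cross_moment_noise ltn_eqF.
Qed.

Lemma cross_moment_responseS t :
  cross_moment P (y t.+1) (y t.+1) = W + F *m cross_moment P (y t) (y t) *m F^T.
Proof.
have step (u v : T -> 'cV[R]_n) : L2v P u -> L2v P v ->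
    cross_moment P u v = 0 ->
    cross_moment P (fun o => F *m u o + v o) (fun o => F *m u o + v o)
      = cross_moment P v v + F *m cross_moment P u u *m F^T.
  move=> u2 v2 uv; have Fu2 := L2v_mulmx F u2; have S2 := L2vD Fu2 v2.
  rewrite cross_momentDl// !cross_momentDr// cross_moment_mull//.
  rewrite !cross_moment_mulr// cross_moment_mull// -(cross_moment_tr _ u v).
  by rewrite uv trmx0 mul0mx mulmx0 addr0 add0r addrC mulmxA.
have := step _ _ (noise_response_L2 t) (noise_L2 t)
  (cross_moment_response_noise (leqnn t)).
by rewrite cross_moment_noise eqxx.
Qed.

Lemma cvg_cross_moment_response :
  (fun t => cross_moment P (y t) (y t)) @ \oo --> Sg.
Proof.
(* The response starts at 0, that is, at distance -Sg from the fixed point, and the affine recursion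
   transports this distance. *)
have YE t : cross_moment P (y t) (y t) = Sg + F ^+ t *m (- Sg) *m (F^T) ^+ t.
  elim: t => [|t IH].
    rewrite !expr0 mul1mx mulmx1 subrr.
    rewrite /cross_moment /=; under eq_fun do rewrite mul0mx.
    exact: mean_mx_cst.
  rewrite cross_moment_responseS IH mulmxDr mulmxDl addrA -stat_cov_eq//.
  by rewrite [in RHS]exprS [in RHS]exprSr !mulmxA.
under eq_fun do rewrite YE.
have c : (fun t => F ^+ t *m (- Sg) *m (F^T) ^+ t) @ \oo --> (0 *m (- Sg) *m 0
  : 'M[R]_n).
  apply: cvg_mulmx; last exact: power_cvg0_tr.
  by apply: cvg_mulmx => //; exact: cvg_cst.
have c0 : (fun _ : nat => Sg) @ \oo --> Sg by exact: cvg_cst.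
by have := cvgD c0 c; rewrite mulmx0 addr0; exact.
Qed.

(** Confines the initial state, and any dependence of it on the noise, to one term multiplied by
    F^t. *)
Lemma stateE t o :
  state A B w x0 X t o = (F ^+ t *m (x0 o + - xbar) + y t o) + xbar.
Proof.
elim: t => [|t IH]; first by rewrite /= expr0 mul1mx addr0 subrK.
rewrite [LHS]/= -/(state A B w x0 X t o) /control.
have -> (x : 'cV[R]_n) : A *m x + B *m (- (gain X *m x) + offset X) + w t o
    = F *m x + B *m offset X + wbar + (w t o - wbar).
  rewrite mulmxDr mulmxN /closed_loop mulmxBl -!mulmxA.
  move: (A *m x) (B *m (gain X *m x)) (B *m offset X) wbar (w t o) => a b c e f.
  by apply/colP => i; rewrite !mxE; ring.
rewrite IH [RHS]/= -/(y t o) exprS -[F * _]/(F *m _) !mulmxDr -!mulmxA.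
rewrite [X in _ = _ + X](stat_mean_eq wbar F0).
move: (F *m (F ^+ t *m x0 o)) (F *m (F ^+ t *m - xbar)) (F *m y t o) (F *m
  xbar).
move: (B *m offset X) (w t o - wbar) wbar => a b c e f g h.
by apply/colP => i; rewrite !mxE; ring.
Qed.

Local Notation dev t := (fun o => F ^+ t *m (x0 o + - xbar) + y t o).

Lemma dev0_L2 : L2v P (fun o => x0 o + - xbar).
Proof. by apply: L2vD => //; exact: L2v_cst. Qed.

Lemma dev_L2 t : L2v P (dev t).
Proof.
exact: L2vD (L2v_mulmx (F ^+ t) dev0_L2) (noise_response_L2 t).
Qed.

Lemma cvg_mean_dev : (fun t => mean_mx P (dev t)) @ \oo --> (0 : 'cV[R]_n).
Proof.
have mE t : mean_mx P (dev t) = F ^+ t *m mean_mx P (fun o => x0 o + - xbar).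
  have Fe2 := L2v_mulmx (F ^+ t) dev0_L2.
  rewrite (mean_mxD (L2v_L1mx Fe2) (L2v_L1mx (noise_response_L2 t))).
  by rewrite mean_noise_response addr0 (mean_mx_mull _ (L2v_L1mx dev0_L2)).
under eq_fun do rewrite mE.
have -> : (0 : 'cV[R]_n) = (0 : 'M[R]_n) *m mean_mx P (fun o => x0 o + - xbar).
  by rewrite mul0mx.
by apply: cvg_mulmx => //; exact: cvg_cst.
Qed.

Lemma cvg_cross_moment_dev : (fun t => cross_moment P (dev t) (dev t)) @ \oo
    --> Sg.
Proof.
pose e o := x0 o + - xbar; pose C := cross_moment P e e.
pose D t := cross_moment P e (y t).
have e2 : L2v P e := dev0_L2.
have step (M : 'M[R]_n) (u : T -> 'cV[R]_n) : L2v P u ->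
    cross_moment P (fun o => M *m e o + u o) (fun o => M *m e o + u o)
    = (M *m C *m M^T + M *m cross_moment P e u) + ((M *m cross_moment P e u)^T
       + cross_moment P u u).
  move=> u2; have Me2 := L2v_mulmx M e2; have S2 := L2vD Me2 u2.
  rewrite cross_momentDl// !cross_momentDr// !cross_moment_mull//.
  rewrite !cross_moment_mulr// -(cross_moment_tr _ e u) trmx_mul.
  by rewrite mulmxA.
under eq_fun do rewrite (step _ _ (noise_response_L2 _)).
(* e and y t may be correlated. The entries of D t are dominated by sums of second moments, which
   converge, and F^t makes the product vanish. *)
have FD : (fun t => F ^+ t *m D t) @ \oo --> (0 : 'M[R]_n).
  apply: (@cvg_mulmx0_bounded _ _ _ _ _ _ _ _ _
    (fun t => \matrix_(i, j) (C i i + cross_moment P (y t) (y t) j j))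
    (\matrix_(i, j) (C i i + Sg j j))) => //.
    move=> t i j; rewrite [leRHS]mxE /D !cross_momentE.
    apply: le_trans (Ex_mul_le _ _) _; [exact: e2|exact: noise_response_L2|].
    by rewrite le_eqVlt; apply/orP; left; apply/eqP; congr (_ + _);
      congr (Ex _ _); apply/funext => o; rewrite expr2.
  apply/cvg_mxP => i j; rewrite mxE; under eq_fun do rewrite mxE.
  apply: cvgD; first exact: cvg_cst.
  exact: ((cvg_mxP _ _).1 cvg_cross_moment_response j j).
have -> : Sg = (0 *m C *m 0 + 0) + (0^T + Sg) by rewrite trmx0 mulmx0 !add0r.
apply: cvgD; apply: cvgD.
- apply: cvg_mulmx; last by have := cvg_trmx F0; rewrite trmx0; exact.
  by apply: cvg_mulmx => //; exact: cvg_cst.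
- exact: FD.
- exact: cvg_trmx FD.
- exact: cvg_cross_moment_response.
Qed.

Variables (H : 'M[R]_(n + 1)).

Local Notation aug t := (fun o => col_mx (state A B w x0 X t o) (- 1%:M) :
  'cV[R]_(n + 1)).

Lemma augE t : aug t =
  (fun o => (col_mx 1%:M 0 : 'M[R]_(n + 1,
    n)) *m dev t o + col_mx xbar (- 1%:M)).
Proof.
apply/funext => o; rewrite stateE mul_col_mx mul1mx mul0mx add_col_mx.
by rewrite add0r.
Qed.

Lemma aug_L2 t : L2v P (aug t).
Proof.
by rewrite augE; apply: L2vD; [exact/L2v_mulmx/dev_L2|exact: L2v_cst].
Qed.

Lemma cvg_cross_moment_aug :
  (fun t => cross_moment P (aug t) (aug t)) @ \oo --> Phi_mx A B wbar W X.
Proof.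
pose U : 'M[R]_(n + 1, n) := col_mx 1%:M 0.
pose c : 'cV[R]_(n + 1) := col_mx xbar (- 1%:M).
have step (v : T -> 'cV[R]_n) : L2v P v ->
    cross_moment P (fun o => U *m v o + c) (fun o => U *m v o + c)
    = (U *m cross_moment P v v *m U^T + U *m (mean_mx P v *m c^T))
      + ((U *m (mean_mx P v *m c^T))^T + c *m c^T).
  move=> v2; have Uv2 := L2v_mulmx U v2; have c2 := L2v_cst P c.
  have S2 := L2vD Uv2 c2.
  rewrite cross_momentDl// !cross_momentDr// !cross_moment_mull//.
  rewrite !cross_moment_mulr// !cross_moment_cstr//
    -(cross_moment_tr _ v (fun=> c)).
  by rewrite cross_moment_cstr// mean_mx_cst !trmx_mul !mulmxA.
under eq_fun do rewrite augE (step _ (dev_L2 _)).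
have -> : Phi_mx A B wbar W X = (U *m Sg *m U^T + U *m (0 *m c^T))
      + ((U *m (0 *m c^T))^T + c *m c^T).
  rewrite mul0mx mulmx0 trmx0 addr0 add0r /U /c !tr_col_mx !mul_col_mx.
  rewrite !mul_mx_row !mul1mx !mul0mx trmx1 !mulmx1 trmx0 !mulmx0 linearN /=
    trmx1.
  rewrite !mulNmx !mulmxN !mulmx1 !mul1mx opprK.
  by rewrite -[col_mx (row_mx _ _) _]/(block_mx _ _ _ _) -[col_mx (row_mx (xbar
    *m _) _) _]/(block_mx _ _ _ _) add_block_mx !add0r.
have c0 := cvg_mean_dev; have c1 := cvg_cross_moment_dev.
have cv : (fun t => U *m (mean_mx P (dev t) *m c^T)) @ \oo --> U *m (0 *m c^T).
  apply: cvg_mulmx; first exact: cvg_cst.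
  by apply: cvg_mulmx => //; exact: cvg_cst.
apply: cvgD; apply: cvgD => //.
- apply: cvg_mulmx; last exact: cvg_cst.
  by apply: cvg_mulmx => //; exact: cvg_cst.
- exact: cvg_trmx cv.
- exact: cvg_cst.
Qed.

(** The expected stage costs converge, so their Cesaro means converge to the same value and [lim] is
    a true limit. *)
Lemma cvg_time_average (f : 'cV[R]_n -> R) :
  (forall x, f x = qform H (col_mx x (- 1%:M))) ->
  lim ((fun N : nat => N%:R^-1 * fine 'E_P[fun o =>
    \sum_(t < N) f (state A B w x0 X t o)]) @ \oo)
  = \tr (H *m Phi_mx A B wbar W X).
Proof.
move=> fH; pose u t := \tr (H *m cross_moment P (aug t) (aug t)).
have cu : u @ \oo --> \tr (H *m Phi_mx A B wbar W X).
  apply: cvg_mxtrace; apply: cvg_mulmx; first exact: cvg_cst.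
  exact: cvg_cross_moment_aug.
have fE t o : f (state A B w x0 X t o) = \tr (H *m (aug t o *m (aug t o)^T)).
  by rewrite fH mulmxA mxtrace_mulC /mxtrace big_ord1.
have -> : (fun N : nat => N%:R^-1 * fine 'E_P[fun o =>
    \sum_(t < N) f (state A B w x0 X t o)]) = (fun N => N%:R^-1 * \sum_(t < N)
      u t).
  apply/funext => N; congr (_ * _); rewrite -/(Ex P _) Ex_sum.
    apply: eq_bigr => t _; under eq_fun do rewrite fE.
    by apply: (mean_mxtrace H _ _).2; exact: aug_L2.
  move=> t; under eq_fun do rewrite fE.
  by apply: (mean_mxtrace H _ _).1; exact: aug_L2.
(* The Cesaro mean of index N averages N + 1 terms, hence the shift past N = 0. *)
apply/cvg_lim => //; rewrite -cvg_shiftS /=.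
have := cesaro cu; rewrite /arithmetic_mean /series /=.
by under eq_fun do rewrite big_mkord.
Qed.

End lagrangian_limit.

(** * Cost differences and the gradient *)

(** Moving the policy by D moves the loop L by - U D. The linear and quadratic coefficients in D are
    the E and M of the cost identity. *)
Lemma quadratic_expansion (R : realType) (k m : nat) (U : 'M[R]_(k,
    m)) (P : 'M[R]_k)
    (Ru : 'M[R]_m) (L : 'M[R]_k) (X D : 'M[R]_(m, k)) : P^T = P -> Ru^T = Ru ->
  (X + D)^T *m Ru *m (X + D) + (L - U *m D)^T *m P *m (L - U *m D)
  = X^T *m Ru *m X + L^T *m P *m L +
    (D^T *m (Ru *m X - U^T *m P *m L) + (Ru *m X - U^T *m P *m L)^T *m D
     + D^T *m (Ru + U^T *m P *m U) *m D).
Proof.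
move=> sP sRu.
have trB p q (M N : 'M[R]_(p, q)) : (M - N)^T = M^T - N^T by rewrite linearB.
have trD p q (M N : 'M[R]_(p, q)) : (M + N)^T = M^T + N^T by rewrite linearD.
rewrite !trB trD !trmx_mul !trmxK sRu sP.
rewrite !(mulmxDl, mulmxDr, mulmxN, mulNmx) !mulmxA.
move: (X^T *m Ru *m X) (X^T *m Ru *m D) (D^T *m Ru *m X) (D^T *m Ru *m D).
move: (L^T *m P *m L) (L^T *m P *m U *m D) (D^T *m U^T *m P *m L).
move: (D^T *m U^T *m P *m U *m D) => a1 a2 a3 a4 a5 a6 a7 a8.
by apply/matrixP => i j; rewrite !mxE; ring.
Qed.

Section augmented_lqr.
Context {R : realType} {n m : nat}.
Variables (A : 'M[R]_n) (B : 'M[R]_(n, m)) (wbar : 'cV[R]_n) (W : 'M[R]_n).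
Variables (Qm : 'M[R]_n) (S : 'cV[R]_n) (Ru : 'M[R]_m) (c : R).
Hypotheses (W_posdef : posdef W) (Qm_psd : psd Qm) (Ru_posdef : posdef Ru).
Local Notation F X := (closed_loop A B X).
Local Notation Sg X := (stat_cov A B W X).
Local Notation xbar X := (stat_mean A B wbar X).
Local Notation Phi X := (Phi_mx A B wbar W X).
Local Notation stable X := (spectral_radius (F X) < 1).

(** The mean noise joins the dynamics with a minus sign because the appended coordinate is -1; the
    sign of S in [aug_const] has the same origin. *)
Definition aug_dyn : 'M[R]_(n + 1) := block_mx A (- wbar) 0 1%:M.
Definition aug_input : 'M[R]_(n + 1, m) := col_mx B 0.
Definition aug_loop X := aug_dyn - aug_input *m X.
Definition aug_noise : 'M[R]_(n + 1) := block_mx W 0 0 0.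
Definition aug_const : 'M[R]_(n + 1) := block_mx Qm (- S) (- S^T) (- c)%:M.
Definition aug_cost (X : 'M[R]_(m, n + 1)) := aug_const + X^T *m Ru *m X.
Definition gain_cost X := Qm + (gain X)^T *m Ru *m gain X.

Lemma policyE (X : 'M[R]_(m, n + 1)) : X = row_mx (gain X) (offset X).
Proof. by rewrite hsubmxK. Qed.

Lemma aug_loopE X :
  aug_loop X = block_mx (F X) (- (wbar + B *m offset X)) 0 1%:M.
Proof.
rewrite /aug_loop /aug_dyn /aug_input {1}(policyE X) mul_col_mx !mul_mx_row
  !mul0mx.
rewrite -[col_mx (row_mx _ _) _]/(block_mx _ _ _ _) opp_block_mx add_block_mx.
by rewrite !oppr0 !addr0 -opprD.
Qed.

Lemma gain_cost_psd X : psd (gain_cost X).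
Proof. by apply: psdD => //; apply/psd_congr/posdef_psd. Qed.

Lemma stable_power X : stable X -> power_cvg0 (F X).
Proof. exact: stable_power_cvg0. Qed.

Lemma stat_cov_psd X : stable X -> psd (Sg X).
Proof.
move=> sX; rewrite stat_covE; last exact: stable_power.
have := stein_psd (power_cvg0_tr (stable_power sX)) (posdef_psd W_posdef).
by rewrite trmxK.
Qed.

Lemma stat_cov_posdef X : stable X -> posdef (Sg X).
Proof.
move=> sX; have [sS S0] := stat_cov_psd sX; split=> // x x0.
rewrite (stat_cov_eq W (stable_power sX)) qform_addmx.
by apply: ltr_wpDr (W_posdef.2 x x0); rewrite -{1}[F X]trmxK qform_congr S0.
Qed.

(** Makes definiteness visible: for x nonzero the covariance is positive, and for x = 0 the square
    is s^2. *)
Lemma qform_Phi X (x : 'cV[R]_n) (s : R) :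
  qform (Phi X) (col_mx x s%:M) = qform (Sg X) x + (inner (xbar X) x - s) ^+ 2.
Proof.
rewrite /qform /Phi_mx mul_block_col inner_block !mulmxDl !innerDr -mulmxA.
have -> : inner x (xbar X *m ((xbar X)^T *m x)) = inner (xbar X) x ^+ 2.
  rewrite inner_mulmx /inner trmx_mul trmxK.
  by rewrite [x^T *m xbar X]mx11_scalar mul_scalar_mx mxE -/(inner _ _)
    -/(inner _ _) innerC expr2.
have -> : inner x (- xbar X *m s%:M) = - (s * inner (xbar X) x).
  by rewrite mul_mx_scalar innerZr innerNr innerC mulrN.
have sv (v : 'cV[R]_1) : inner s%:M v = s * v 0 0.
  by rewrite /inner tr_scalar_mx mul_scalar_mx mxE.
rewrite !sv mulNmx mul1mx mxE -/(inner (xbar X) x) mxE eqxx mulr1n; ring.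
Qed.

Lemma Phi_sym X : stable X -> (Phi X)^T = Phi X.
Proof.
move=> sX; rewrite /Phi_mx tr_block_mx; congr block_mx.
- by rewrite linearD /= (stat_cov_psd sX).1 trmx_mul trmxK.
- by rewrite linearN /= trmxK.
- by rewrite linearN.
- by rewrite trmx1.
Qed.

Lemma Phi_posdef X : stable X -> posdef (Phi X).
Proof.
move=> sX; split=> [|z z0]; first exact: Phi_sym.
rewrite -[z]vsubmxK [dsubmx z]mx11_scalar qform_Phi.
have [x0|x0] := eqVneq (usubmx z) 0.
  have s0 : dsubmx z 0 0 != 0.
    apply: contra z0 => /eqP s0;
      rewrite -[z]vsubmxK x0 [dsubmx z]mx11_scalar s0.
    by rewrite raddf0 col_mx0.
  rewrite x0 /qform inner0l inner0r add0r sub0r sqrrN.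
  by rewrite lt_neqAle sqr_ge0 eq_sym sqrf_eq0 s0.
by apply: ltr_wpDr; [exact: sqr_ge0|exact: (stat_cov_posdef sX).2].
Qed.

Lemma Phi_fixpoint X : stable X ->
  Phi X = aug_loop X *m Phi X *m (aug_loop X)^T + aug_noise.
Proof.
move=> sX; have F0 := stable_power sX.
rewrite aug_loopE /Phi_mx /aug_noise tr_block_mx !mulmx_block add_block_mx.
rewrite !trmx0 !trmx1 !mulmx0 !mul0mx !mul1mx !mulmx1 !add0r !addr0.
have xE : xbar X = F X *m xbar X + (wbar + B *m offset X).
  by rewrite {1}(stat_mean_eq wbar F0) -addrA [X in _ + X]addrC.
set f := wbar + _ in xE *; set x := xbar X in xE *; set G := F X in xE *.
have fE : f = x - G *m x by apply/eqP; rewrite eq_sym subr_eq addrC -xE.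
have tE : (- f)^T = x^T *m G^T - x^T by rewrite fE opprB linearB /= trmx_mul.
congr block_mx.
- rewrite {1}(stat_cov_eq W F0) -/G tE fE; set Z := stat_cov _ _ _ _.
  rewrite !opprB !(mulmxDl, mulmxDr, mulmxN, mulNmx) !mulmxA.
  move: (G *m Z *m G^T) (G *m x *m x^T *m G^T) (G *m x *m x^T) (x *m x^T *m
    G^T) (x *m x^T).
  by move=> a1 a2 a3 a4 a5; apply/matrixP => i j; rewrite !mxE; ring.
- by rewrite fE mulmxN opprB addrA addNr add0r.
- by rewrite mul1mx tE mulNmx addrA addNr add0r.
Qed.

(** Solved block by block because [aug_loop X] has the eigenvalue 1. The upper left block is a
    Lyapunov equation, the off-diagonal one is linear with the invertible matrix 1 - F^T. In the
    corner the unknown cancels, so it is set to 0 and the residue c1 stays. *)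
Lemma value_matrix X : stable X -> exists (Pt : 'M[R]_(n + 1)) (c1 : R),
  [/\ Pt^T = Pt, psd (aug_input^T *m Pt *m aug_input) &
     aug_cost X + (aug_loop X)^T *m Pt *m aug_loop X - Pt
       = block_mx 0 0 0 c1%:M].
Proof.
move=> sX; have F0 := stable_power sX; have Ft := power_cvg0_tr F0.
pose PK := stein (F X)^T (F X) (gain_cost X).
have PK_psd : psd PK := stein_psd F0 (gain_cost_psd X).
have PKE : PK = gain_cost X + (F X)^T *m PK *m F X by exact: stein_eq.
pose f := - (wbar + B *m offset X).
pose r := - S + (gain X)^T *m Ru *m offset X + (F X)^T *m PK *m f.
have ut := power_cvg0_sub1_unit Ft.
pose g := invmx (1%:M - (F X)^T) *m r.
have gE : r + (F X)^T *m g = g.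
  have : (1%:M - (F X)^T) *m g = r by rewrite /g mulKVmx.
  by rewrite mulmxBl mul1mx => <-; rewrite subrK.
have [sRu _] := Ru_posdef.
have scalar11 (M : 'M[R]_1) : exists a, a%:M = M by exists (M 0 0);
  rewrite -mx11_scalar.
have [c1 c1E] := scalar11 ((- c)%:M + (offset X)^T *m Ru *m offset X
    + (f^T *m (PK *m f + g) + g^T *m f)).
exists (block_mx PK g g^T 0), c1; split.
- by rewrite tr_block_mx trmxK PK_psd.1 trmx0.
- rewrite /aug_input tr_col_mx mul_row_block mul_row_col trmx0 !mul0mx !mulmx0
  !addr0.
  exact: psd_congr.
rewrite /aug_cost /aug_const aug_loopE -/f tr_block_mx !mulmx_block.
rewrite [X in X^T *m Ru *m X](policyE X) tr_row_mx mul_col_mx mul_col_row.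
rewrite opp_block_mx !add_block_mx !trmx0 !trmx1 !mulmx0 !mul0mx !mul1mx
  !mulmx1 !addr0.
congr block_mx.
- by rewrite -/(gain_cost X) -PKE subrr.
- by rewrite addrA -/r gE subrr.
- have rT : r^T = - S^T + (offset X)^T *m Ru *m gain X + f^T *m PK *m F X.
    have trD (a1 a2 a3 : 'cV[R]_n) : (- a1 + a2 + a3)^T = - a1^T + a2^T + a3^T.
      by rewrite !linearD linearN.
    by rewrite /r trD !trmx_mul !trmxK sRu PK_psd.1 !mulmxA.
  rewrite mulmxDl addrA -rT; apply/eqP; rewrite subr_eq0; apply/eqP.
  clearbody g; clearbody r.
  have trD2 (a1 a2 : 'cV[R]_n) : (a1 + a2)^T = a1^T + a2^T by rewrite linearD.
  by rewrite -[in RHS]gE trD2 trmx_mul trmxK.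
- by rewrite c1E subr0 mulmxDl mulmxDr !mulmxA; congr (_ + _); rewrite addrAC.
Qed.

(** The corner of every Phi is 1, so the residue of the value equation costs all policies the same
    and cancels from differences. *)
Lemma mxtrace_Phi_corner X a : \tr (Phi X *m block_mx 0 0 0 a%:M) = a.
Proof.
rewrite /Phi_mx mulmx_block !mulmx0 !addr0 mxtrace_block mxtrace0 add0r.
by rewrite mul1mx add0r mxtrace_scalar mulr1n.
Qed.

(** E and M depend on X only. The identity is exact, not a Taylor expansion, because the moment
    matrix is taken at the target Y. *)
Lemma cost_difference X : stable X ->
    exists (E : 'M[R]_(m, n + 1)) (M : 'M[R]_m),
  psd (M - Ru) /\ forall Y, stable Y ->
   \tr (aug_cost Y *m Phi Y) - \tr (aug_cost X *m Phi X)
   = 2 * \tr (Phi Y *m ((Y - X)^T *m E))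
     + \tr (Phi Y *m ((Y - X)^T *m M *m (Y - X))).
Proof.
move=> sX; have [Pt [c1 [sPt psdM PtE]]] := value_matrix sX.
have [sRu _] := Ru_posdef.
exists (Ru *m X - aug_input^T *m Pt *m aug_loop X),
  (Ru + aug_input^T *m Pt *m aug_input).
split; first by rewrite addrC addKr.
set E := Ru *m X - _; set M := Ru + _.
(* Pairing the fixed-point equation of Phi Y with Pt trades Pt for its transport by the loop of Y,
   up to a noise term independent of Y. *)
have key Y : stable Y -> \tr (aug_cost Y *m Phi Y) =
    \tr (Phi Y *m (aug_cost Y + (aug_loop Y)^T *m Pt *m aug_loop Y - Pt))
    + \tr (aug_noise *m Pt).
  move=> sY.
  have PhiPt : \tr (Phi Y *m Pt) = \tr (Phi Y *m ((aug_loop Y)^T *m Pt *m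
    aug_loop Y))
      + \tr (aug_noise *m Pt).
    rewrite {1}(Phi_fixpoint sY) mulmxDl mxtraceD; congr (_ + _).
    by rewrite -!mulmxA mxtrace_mulC !mulmxA.
  have trB (M1 M2 : 'M[R]_(n + 1)) :
    \tr (M1 - M2) = \tr M1 - \tr M2 by rewrite linearB.
  by rewrite mulmxBr mulmxDr trB mxtraceD PhiPt [in LHS]mxtrace_mulC; ring.
have GE Y : aug_cost Y + (aug_loop Y)^T *m Pt *m aug_loop Y - Pt =
    block_mx 0 0 0 c1%:M + ((Y - X)^T *m E + E^T *m (Y - X) + (Y - X)^T *m M *m
      (Y - X)).
  have YX : Y = X + (Y - X) by rewrite addrC subrK.
  have LYX : aug_loop Y = aug_loop X - aug_input *m (Y - X).
    by rewrite /aug_loop mulmxBr opprB addrA subrK.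
  rewrite -PtE /aug_cost LYX {1 2}YX -(addrA aug_const) (quadratic_expansion _
    _ _ _ sPt sRu).
  by rewrite -!addrA [- Pt + _]addrC !addrA.
have GX : aug_cost X + (aug_loop X)^T *m Pt *m aug_loop X - Pt = block_mx 0 0 0
  c1%:M.
  by rewrite GE subrr trmx0 !mul0mx !mulmx0 !addr0.
have trD (N C a1 a2 a3 : 'M[R]_(n + 1)) : \tr (N *m (C + (a1 + a2 + a3)))
    = \tr (N *m C) + (\tr (N *m a1) + \tr (N *m a2) + \tr (N *m a3)).
  by rewrite !mulmxDr !mxtraceD.
move=> Y sY; rewrite (key Y sY) (GE Y) trD (key X sX) GX.
rewrite !mxtrace_Phi_corner.
have -> : \tr (Phi Y *m (E^T *m (Y - X))) = \tr (Phi Y *m ((Y - X)^T *m E)).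
  rewrite -mxtrace_tr !trmx_mul !trmxK (Phi_sym sY) mxtrace_mulC.
  by [].
by ring.
Qed.

End augmented_lqr.

Lemma posdef_perturb_id (R : realType) n (N : 'M[R]_n) :
  N^T = N -> \tr (N *m N^T) < 1 -> posdef (1%:M + N).
Proof.
move=> sN N1; split=> [|x x0]; first by rewrite linearD /= trmx1 sN.
rewrite qform_addmx qform1; have ix : 0 < inner x x by rewrite inner_gt0.
have : qform N x ^+ 2 < inner x x ^+ 2.
  apply: le_lt_trans (cauchy_schwarz _ _) _; rewrite expr2 ltr_pM2l//.
  by apply: le_lt_trans (frobenius_bound _ _) _; rewrite gtr_pMl.
by move=> h; nra.
Qed.

Lemma gradient_entry_dir (R : realType) p q (N : 'M[R]_(p, q)) i j :
  \tr ((delta_mx i j)^T *m N) = N i j.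
Proof.
rewrite trmx_delta /mxtrace (bigD1 j)//= big1 => [|k /negbTE kj].
  rewrite addr0 mxE (bigD1 i)//= big1 => [|l /negbTE li].
    by rewrite !mxE !eqxx mul1r addr0.
  by rewrite !mxE li andbF mul0r.
by rewrite mxE big1// => l _; rewrite !mxE kj mul0r.
Qed.

(** * Openness of stability and continuity of the stationary moments *)

Section stabilizing_continuity.
Context {R : realType} {n m : nat}.
Variables (A : 'M[R]_n) (B : 'M[R]_(n, m)) (wbar : 'cV[R]_n) (W : 'M[R]_n).
Local Notation F X := (closed_loop A B X).
Local Notation Phi X := (Phi_mx A B wbar W X).
Local Notation stable X := (spectral_radius (F X) < 1).

Section along_filter.
Context {T : Type} {E : set_system T} {FE : Filter E}.
Variables (f : T -> 'M[R]_(m, n + 1)) (X : 'M[R]_(m, n + 1)).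
Hypothesis fX : f @ E --> X.

Lemma cvg_gain : (fun t => gain (f t)) @ E --> gain X.
Proof. exact: (cvg_comp _ _ fX (@continuous_lsubmx _ _ _ _ X)). Qed.

Lemma cvg_offset : (fun t => offset (f t)) @ E --> offset X.
Proof. exact: (cvg_comp _ _ fX (@continuous_rsubmx _ _ _ _ X)). Qed.

Lemma cvg_closed_loop : (fun t => F (f t)) @ E --> F X.
Proof.
apply: cvgB; first exact: cvg_cst.
by apply: cvg_mulmx; [exact: cvg_cst|exact: cvg_gain].
Qed.

(** The solution P of P = 1 + F^T P F at X still certifies nearby loops G, since P - G^T P G stays
    close to the identity. No continuity of eigenvalues is involved. *)
Lemma near_stable : stable X -> \forall t \near E, stable (f t).
Proof.
move=> sX; have F0 := stable_power_cvg0 sX; have Ft := power_cvg0_tr F0.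
have I_psd : psd (1%:M : 'M[R]_n).
  by split=> [|x]; [exact: trmx1|rewrite qform1 inner_ge0].
pose P := stein (F X)^T (F X) 1%:M.
have P_psd : psd P := stein_psd F0 I_psd.
pose N t := P - (F (f t))^T *m P *m F (f t) - 1%:M.
have N0 : N @ E --> (0 : 'M[R]_n).
  have -> : 0 = P - (F X)^T *m P *m F X - 1%:M.
    by rewrite {1}/P stein_eq// -/P addrK subrr.
  apply: cvgB; last exact: cvg_cst.
  apply: cvgB; first exact: cvg_cst.
  apply: cvg_mulmx; last exact: cvg_closed_loop.
  apply: cvg_mulmx; last exact: cvg_cst.
  exact/cvg_trmx/cvg_closed_loop.
have sN t : (N t)^T = N t.
  have trB (M1 M2 : 'M[R]_n) : (M1 - M2)^T = M1^T - M2^T by rewrite linearB.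
  rewrite /N; move: (F (f t)) => G.
  by rewrite !trB trmx_congr ?P_psd.1// trmx1.
have trN : (fun t => \tr (N t *m (N t)^T)) @ E -->
    \tr ((0 : 'M[R]_n) *m (0 : 'M[R]_n)^T).
  by apply: cvg_mxtrace; apply: cvg_mulmx => //; exact: cvg_trmx.
rewrite mul0mx mxtrace0 in trN.
have := @cvgr_lt _ _ _ FE _ _ trN _ (@ltr01 R).
apply: filterS => t Nt.
have D_pos := posdef_perturb_id (sN t) Nt.
have DE : 1%:M + N t = P - (F (f t))^T *m P *m F (f t) by rewrite /N addrC
  subrK.
apply: (@lyapunov_stable _ _ _ P (1%:M + N t)) => //.
- exact: posdef_psd.
- by rewrite DE subrK.
move=> a b p q _ _ _ Da Db.
have D0 (x : 'cV[R]_n) : (1%:M + N t) *m x = 0 -> x = 0.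
  move=> Dx; apply/eqP/negPn/negP => /(D_pos.2).
  by rewrite /qform Dx inner0r ltxx.
by split; exact: D0.
Qed.

(** [stat_mean] and [stat_cov] have closed forms only at stabilizing policies. The closed forms
    converge, and openness of stability makes them agree eventually. *)
Lemma cvg_Phi : stable X -> (fun t => Phi (f t)) @ E --> Phi X.
Proof.
move=> sX; have F0 := stable_power_cvg0 sX; have Ft := power_cvg0_tr F0.
have cF := cvg_closed_loop.
have cx : (fun t => stat_mean A B wbar (f t)) @ E --> stat_mean A B wbar X.
  rewrite (stat_meanE wbar F0).
  have c : (fun t => invmx (1%:M - F (f t)) *m (B *m offset (f t) + wbar)) @ E
      --> invmx (1%:M - F X) *m (B *m offset X + wbar).
    apply: cvg_mulmx.
      apply: cvg_invmx; first exact: power_cvg0_sub1_unit.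
      by apply: cvgB => //; exact: cvg_cst.
    apply: cvgD; last exact: cvg_cst.
    by apply: cvg_mulmx; [exact: cvg_cst|exact: cvg_offset].
  apply: cvg_trans c; apply: near_eq_cvg.
  apply: filterS (near_stable sX) => t st.
  by rewrite (stat_meanE wbar (stable_power_cvg0 st)).
have cS : (fun t => stat_cov A B W (f t)) @ E --> stat_cov A B W X.
  rewrite (stat_covE W F0).
  have c : (fun t => stein (F (f t)) (F (f t))^T W) @ E --> stein (F X) (F X)^T
    W.
    apply: cvg_stein; [exact: stein_mx_unit|exact: cF|exact: cvg_trmx|exact:
      cvg_cst].
  apply: cvg_trans c; apply: near_eq_cvg.
  apply: filterS (near_stable sX) => t st.
  by rewrite (stat_covE W (stable_power_cvg0 st)).
rewrite /Phi_mx; apply: cvg_block_mx.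
- by apply: cvgD => //; apply: cvg_mulmx => //; exact: cvg_trmx.
- exact: (cvgN cx).
- exact: (cvgN (cvg_trmx cx)).
- exact: cvg_cst.
Qed.

End along_filter.
End stabilizing_continuity.

Section gradient.
Context {R : realType} {n m : nat}.
Variables (A : 'M[R]_n) (B : 'M[R]_(n, m)) (wbar : 'cV[R]_n) (W : 'M[R]_n).
Local Notation F X := (closed_loop A B X).
Local Notation Phi X := (Phi_mx A B wbar W X).
Local Notation stable X := (spectral_radius (F X) < 1).
Variables (L : 'M[R]_(m, n + 1) -> R) (X E : 'M[R]_(m, n + 1)) (M : 'M[R]_m).
Hypothesis W_posdef : posdef W.
Hypothesis sX : stable X.
Hypothesis LE : forall Y, stable Y ->
  L Y - L X = 2 * \tr (Phi Y *m ((Y - X)^T *m E))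
              + \tr (Phi Y *m ((Y - X)^T *m M *m (Y - X))).

(** The difference quotient of L at X along D, in a form that makes sense at h = 0. *)
Let slope (D : 'M[R]_(m, n + 1)) (h : R) :=
  2 * \tr (Phi (h *: D + X) *m (D^T *m E))
  + h * \tr (Phi (h *: D + X) *m (D^T *m M *m D)).

Lemma line_difference (D : 'M[R]_(m, n + 1)) h : stable (h *: D + X) ->
  L (h *: D + X) - L X = h * slope D h.
Proof.
move=> sY; rewrite LE// addrK /slope !linearZ /= -!scalemxAl -!scalemxAr.
by rewrite !mxtraceZ; ring.
Qed.

(** The filter is arbitrary so as to serve both the derivative, with h near 0, and one-sided steps
    along a positive sequence. *)
Lemma cvg_slope T (G : set_system T) {FG : Filter G} (D : 'M[R]_(m,
    n + 1)) (h : T -> R) :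
  h @ G --> 0 ->
  (\forall t \near G, stable (h t *: D + X)) /\
  (fun t => slope D (h t)) @ G --> 2 * \tr (D^T *m (E *m Phi X)).
Proof.
move=> h0.
have c : (fun t => h t *: D + X) @ G --> X.
  have -> : X = 0 *: D + X by rewrite scale0r add0r.
  by apply: cvgD; [exact: cvgZr_tmp|rewrite scale0r add0r; exact: cvg_cst].
split; first exact: near_stable c sX.
have cP : (fun t => Phi (h t *: D + X)) @ G --> Phi X by exact: (cvg_Phi c sX).
have -> : 2 * \tr (D^T *m (E *m Phi X))
    = 2 * \tr (Phi X *m (D^T *m E)) + 0 * \tr (Phi X *m (D^T *m M *m D)).
  by rewrite mul0r addr0 [in RHS]mxtrace_mulC mulmxA.
have cN (N : 'M[R]_(n + 1)) :
    (fun t => \tr (Phi (h t *: D + X) *m N)) @ G --> \tr (Phi X *m N).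
  have cN0 : (fun _ : T => N) @ G --> N by exact: cvg_cst.
  exact: (cvg_mxtrace (cvg_mulmx cP cN0)).
have c2 : (fun _ : T => 2 : R) @ G --> (2 : R) by exact: cvg_cst.
exact: (cvgD (cvgM c2 (cN _)) (cvgM h0 (cN _))).
Qed.

Lemma gradientE : gradient L X = 2 *: (E *m Phi X).
Proof.
apply/matrixP => i j; rewrite !mxE /derive.
have [st cs] := @cvg_slope R (0 : R)^' _ (delta_mx i j) id (@nbhs_dnbhs _ _) .
rewrite gradient_entry_dir in cs.
apply: cvg_lim => //; rewrite -[X in _ --> X](_ : 2 * (E *m Phi X) i j = _);
  last by rewrite mxE.
apply: cvg_trans cs; apply: near_eq_cvg.
have n0 : \forall h \near (0 : R)^', h != 0 by exact: nbhs_dnbhs_neq.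
near=> h.
rewrite line_difference; last by near: h.
by rewrite scalerA mulVf ?scale1r//; near: h.
Unshelve. all: by end_near. Qed.

Lemma minimizer_critical : (forall Y, stable Y -> L X <= L Y) -> E *m Phi X = 0.
Proof.
(* Along steepest descent the slope tends to -2 tr (D^T D); minimality makes it nonnegative for
   positive steps, which forces D = 0. *)
move=> minX; pose D := - (E *m Phi X).
have h0 : (@harmonic R) @ \oo --> 0 by exact: cvg_harmonic.
have [st cs] := cvg_slope D h0.
have ge0 : 0 <= 2 * \tr (D^T *m (E *m Phi X)).
  rewrite -(cvg_lim _ cs)//; apply: limr_ge; first by apply/cvg_ex; eexists;
    exact: cs.
  apply: filterS st => t st.
  have := line_difference st; have := minX _ st;
    rewrite -subr_ge0 => /[swap] ->.
  by rewrite pmulr_rge0// invr_gt0.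
have : \tr (D^T *m D) <= 0.
  rewrite {2}/D mulmxN.
  have trN (N : 'M[R]_(n + 1)) : \tr (- N) = - \tr N by rewrite linearN.
  by rewrite trN; lra.
move=> DD; apply/eqP; rewrite -oppr_eq0 -/D; apply/eqP/matrixP => i j;
  rewrite [RHS]mxE.
have sqD : \sum_j (\sum_i D i j ^+ 2) <= 0.
  move: DD; rewrite /mxtrace; under eq_bigr do rewrite mxE.
  by under eq_bigr do (under eq_bigr do rewrite mxE -expr2).
have [//|Dij] := eqVneq (D i j) 0.
have : 0 < \sum_j (\sum_i D i j ^+ 2).
  rewrite (bigD1 j)//= ltr_pwDl//; last by apply: sumr_ge0 => k _;
    apply: sumr_ge0 => l _; exact: sqr_ge0.
  rewrite (bigD1 i)//= ltr_pwDl//; last by apply: sumr_ge0 => k _;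
    exact: sqr_ge0.
  by rewrite lt_neqAle sqr_ge0 eq_sym sqrf_eq0 Dij.
by rewrite ltNge sqD.
Qed.

Lemma mulmx_Phi_eq0 : E *m Phi X = 0 -> E = 0.
Proof.
move=> EP; apply/trmx_inj; rewrite trmx0; apply/matrixP => i j;
  rewrite [RHS]mxE.
have Pe : Phi X *m E^T = 0 by rewrite -(Phi_sym wbar W_posdef sX) -trmx_mul EP
  trmx0.
have : col j E^T = 0.
  apply/eqP/negPn/negP => /((Phi_posdef wbar W_posdef sX).2).
  by rewrite /qform colE mulmxA Pe mul0mx inner0r ltxx.
by move/colP/(_ i); rewrite !mxE.
Qed.

End gradient.

(** * Compactness of sublevel sets *)

Section entry_bounds.
Context {R : realType} {D : Type}.
Variable C : set D.

Definition bounded_on p q (f : D -> 'M[R]_(p, q)) :=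
  exists b, forall x, C x -> forall i j, `|f x i j| <= b.

Lemma bounded_on_cst p q (M : 'M[R]_(p, q)) : bounded_on (fun=> M).
Proof.
exists (\sum_i \sum_j `|M i j|) => x _ i j.
rewrite (bigD1 i)//= (bigD1 j)//= -addrA lerDl addr_ge0 ?sumr_ge0// => k _.
by rewrite sumr_ge0.
Qed.

Lemma bounded_onD p q (f g : D -> 'M[R]_(p, q)) :
  bounded_on f -> bounded_on g -> bounded_on (fun x => f x + g x).
Proof.
move=> [b fb] [c gc]; exists (b + c) => x Cx i j; rewrite mxE.
by apply: le_trans (ler_normD _ _) _; rewrite lerD ?fb ?gc.
Qed.

Lemma bounded_on_mulmx p q r (f : D -> 'M[R]_(p, q)) (g : D -> 'M[R]_(q, r)) :
  bounded_on f -> bounded_on g -> bounded_on (fun x => f x *m g x).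
Proof.
move=> [b fb] [c gc]; exists (\sum_(k < q) b * c) => x Cx i j; rewrite mxE.
apply: le_trans (ler_norm_sum _ _ _) _; apply: ler_sum => k _.
by rewrite normrM ler_pM ?fb ?gc.
Qed.

Lemma bounded_on_row_mx p q r (f : D -> 'M[R]_(p, q)) (g : D -> 'M[R]_(p, r)) :
  bounded_on f -> bounded_on g -> bounded_on (fun x => row_mx (f x) (g x)).
Proof.
move=> [b fb] [c gc]; exists (Num.max b c) => x Cx i j.
rewrite -(splitK j); case: (fintype.split j) => j' /=.
  by rewrite row_mxEl le_max fb.
by rewrite row_mxEr le_max gc ?orbT.
Qed.

(** The bound comes from |t| <= 1 + t^2, which avoids square roots. *)
Lemma bounded_on_inner p (f : D -> 'cV[R]_p) b :
  (forall x, C x -> inner (f x) (f x) <= b) -> bounded_on f.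
Proof.
move=> fb; exists (1 + b) => x Cx i j; rewrite ord1.
have f1 : f x i 0 ^+ 2 <= b by apply: le_trans (inner_coord_le _ _) (fb _ Cx).
rewrite ler_norml; apply/andP; split.
  by have := sqr_ge0 (f x i 0 + 1); rewrite sqrrD expr1n; nra.
by have := sqr_ge0 (f x i 0 - 1); rewrite sqrrB expr1n; nra.
Qed.

End entry_bounds.

(* Evaluate the form at e_i + e_j and e_i - e_j. *)
Lemma psd_entry_le (R : realType) n (P : 'M[R]_n) i j : psd P ->
    `|P i j| <= \tr P.
Proof.
move=> Ppsd; have [sP P0] := Ppsd.
have e k l : inner (delta_mx k 0) (P *m delta_mx l 0) = P k l.
  by rewrite /inner trmx_delta -colE -rowE !mxE.
have d k : 0 <= P k k by rewrite -e; exact: P0.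
have trP : P i i <= \tr P /\ P j j <= \tr P.
  by split; rewrite /mxtrace; [rewrite (bigD1 i)//=|rewrite (bigD1 j)//=];
    rewrite lerDl sumr_ge0.
have q s : 0 <= P i i + 2 * s * P i j + s ^+ 2 * P j j.
  have := P0 (delta_mx i 0 + s *: delta_mx j 0).
  by rewrite qformD// qformZ -scalemxAr innerZr e /qform !e mulrA.
have := q 1; have := q (-1); rewrite sqrrN !expr1n => h1 h2.
by rewrite ler_norml; apply/andP; split; lra.
Qed.

Lemma observable_inj (R : realType) n p (A : 'M[R]_n) (C : 'M[R]_(p,
    n)) (x : 'cV[R]_n) :
  observable A C -> (forall i, C *m (A ^+ i *m x) = 0) -> x = 0.
Proof.
rewrite /observable => rk h.
set M := mxcol _ in rk.
have Mx : M *m x = 0.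
  apply/row_matrixP => r.
  by rewrite row_mul row_mxcol -row_mul -mulmxA h !row0.
have rf : row_free M^T by rewrite /row_free mxrank_tr rk.
apply: trmx_inj; rewrite trmx0; apply: (row_free_inj rf).
by rewrite mul0mx -trmx_mul Mx trmx0.
Qed.

Section sublevel_sets.
Context {R : realType} {n m : nat}.
Variables (n_gt0 : (0 < n)%N) (m_gt0 : (0 < m)%N).
Variables (A : 'M[R]_n) (B : 'M[R]_(n, m)) (wbar : 'cV[R]_n) (W : 'M[R]_n).
Variables (Q Q2 Qhalf : 'M[R]_n) (v0 : 'cV[R]_n) (Ru : 'M[R]_m) (c alpha : R).
Hypotheses (W_posdef : posdef W) (Q2_psd : psd Q2) (Ru_posdef : posdef Ru).
Hypotheses (Qhalf_sqrt : psd_sqrt Qhalf Q) (AQ_observable : observable A Qhalf).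
Local Notation F X := (closed_loop A B X).
Local Notation Sg X := (stat_cov A B W X).
Local Notation xbar X := (stat_mean A B wbar X).
Local Notation Phi X := (Phi_mx A B wbar W X).
Local Notation stable X := (spectral_radius (F X) < 1).
Local Notation Qm := (Q + Q2).
Local Notation S := (Q *m v0).
Local Notation gcost X := (gain_cost Qm Ru X).
Local Notation acost X := (aug_cost Qm S Ru c X).

Definition mean_cost (X : 'M[R]_(m, n + 1)) (x : 'cV[R]_n) :=
  qform Qm x + 2 * inner x S + qform Ru (control X x) - c.

Definition value_mx (X : 'M[R]_(m, n + 1)) := stein (F X)^T (F X) (gcost X).

Lemma qform_Q x : qform Q x = inner (Qhalf *m x) (Qhalf *m x).
Proof.
have [[sQ _] <-] := Qhalf_sqrt; rewrite -qform1 -qform_congr mulmx1.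
by rewrite sQ.
Qed.

Lemma Q_psd : psd Q.
Proof. by have [[sQ _] <-] := Qhalf_sqrt; rewrite -{1}sQ; exact: psd_gram. Qed.

Lemma Qm_psd : psd Qm. Proof. exact: psdD Q_psd Q2_psd. Qed.

Lemma control_aug (X : 'M[R]_(m, n + 1)) (x : 'cV[R]_n) :
    X *m col_mx x (- 1%:M) = - control X x.
Proof.
rewrite {1}(policyE X) mul_row_col mulmxN mulmx1 /control.
by rewrite opprD opprK.
Qed.

Lemma qform_aug_cost X x : qform (acost X) (col_mx x (- 1%:M)) = mean_cost X x.
Proof.
rewrite /aug_cost qform_addmx qform_congr control_aug /mean_cost.
have -> : qform Ru (- control X x) = qform Ru (control X x).
  by rewrite -scaleN1r qformZ sqrrN expr1n mul1r.
have -> : qform (aug_const Qm S c) (col_mx x (- 1%:M)) = qform Qm x + 2 * inner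
  x S - c.
  rewrite /aug_const {1}/qform mul_block_col inner_block !innerDr.
  rewrite !mulmxN !mulmx1 opprK mulNmx.
  have -> : inner (- 1%:M) (- (S^T *m x)) = inner x S.
    by rewrite innerNl innerNr opprK [RHS]innerC /inner trmx1 mul1mx.
  have -> : inner (- 1%:M : 'cV[R]_1) (- (- c)%:M) = - c.
    by rewrite innerNl innerNr opprK /inner trmx1 mul1mx mxE eqxx mulr1n.
  rewrite -/(qform Qm x); ring.
by ring.
Qed.

Lemma aug_cost_ul X : ulsubmx (acost X) = gcost X.
Proof.
rewrite /aug_cost {1 2}(policyE X) tr_row_mx mul_col_mx mul_col_row /aug_const
  add_block_mx.
by rewrite block_mxKul.
Qed.

(** Phi X is the covariance block plus the rank-one matrix of (xbar, -1). On the covariance, the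
    adjoint Stein equations for P and Sg exchange the two inhomogeneous terms: tr (K Sg) = tr (W P),
    with K the gain cost. *)
Lemma total_costE X : stable X ->
  \tr (acost X *m Phi X) = \tr (W *m value_mx X) + mean_cost X (xbar X).
Proof.
move=> sX; have F0 := stable_power sX; have Ft := power_cvg0_tr F0.
pose z : 'cV[R]_(n + 1) := col_mx (xbar X) (- 1%:M).
have -> : Phi X = block_mx (Sg X) 0 0 0 + z *m z^T.
  rewrite /Phi_mx /z tr_col_mx mul_col_row add_block_mx !add0r linearN /= trmx1.
  by rewrite mulmxN mulNmx !mulmx1 mul1mx mulmxN mulmx1 opprK.
rewrite mulmxDr mxtraceD; congr (_ + _); last first.
  by rewrite mulmxA mxtrace_mulC /mxtrace big_ord1 -qform_aug_cost.
rewrite -[acost X]submxK mulmx_block !mulmx0 !addr0 mxtrace_block mxtrace0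
  addr0.
rewrite aug_cost_ul.
have PE : value_mx X = gcost X + (F X)^T *m value_mx X *m F X by exact:
  stein_eq.
have SE := stat_cov_eq W F0.
move: (value_mx X) (Sg X) PE SE; move: (F X) (gcost X) => G K P Z PE SE.
have -> : K = P - G^T *m P *m G by rewrite {1}PE addrK.
have -> : W = Z - G *m Z *m G^T by rewrite {1}SE addrK.
have trB (M1 M2 : 'M[R]_n) : \tr (M1 - M2) = \tr M1 - \tr M2 by rewrite linearB.
rewrite !mulmxBl !trB; congr (_ - _); first by rewrite mxtrace_mulC.
by rewrite -!mulmxA mxtrace_mulC -!mulmxA mxtrace_mulC -!mulmxA.
Qed.

(** The linear term being Q v0, the square can be completed in the form Q even where Q is
    singular. *)
Lemma mean_cost_ge X x :
  qform Q (x + v0) + qform Ru (control X x) - (qform Q v0 + c) <= mean_cost X x.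
Proof.
rewrite /mean_cost qformD ?Q_psd.1// [qform Qm x]qform_addmx.
by have := Q2_psd.2 x; lra.
Qed.

(** Where the gain cost vanishes, so do Qhalf x and the feedback K x, and the loop acts as A. An
    undamped pair (a, b) would thus span an A-invariant space inside the kernel of Qhalf, which
    observability excludes. *)
Lemma observable_stable X P : psd P -> P = gcost X + (F X)^T *m P *m F X ->
    stable X.
Proof.
move=> P0 PE; apply: (lyapunov_stable P0 _ PE);
  first exact: gain_cost_psd Qm_psd Ru_posdef _.
have Ru_psd := posdef_psd Ru_posdef.
have K0 (x : 'cV[R]_n) : gcost X *m x = 0 ->
  Qhalf *m x = 0 /\ F X *m x = A *m x.
  move=> gx; have : qform (gcost X) x = 0 by rewrite /qform gx inner0r.
  rewrite /gain_cost !qform_addmx qform_congr qform_Q => h.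
  have h1 := inner_ge0 (Qhalf *m x); have h2 := Q2_psd.2 x.
  have h3 := Ru_psd.2 (gain X *m x).
  split; first by apply/eqP; rewrite -inner_eq0; apply/eqP; lra.
  have Kx : gain X *m x = 0.
    apply/eqP/negPn/negP => /(Ru_posdef.2); lra.
  by rewrite /closed_loop mulmxBl -mulmxA Kx mulmx0 subr0.
move=> a b p q _ Fa Fb /K0[Qa FAa] /K0[Qb FAb].
rewrite FAa in Fa; rewrite FAb in Fb.
have h i : Qhalf *m (A ^+ i *m a) = 0 /\ Qhalf *m (A ^+ i *m b) = 0.
  elim: i => [|i [IHa IHb]]; first by rewrite expr0 !mul1mx.
  rewrite exprSr -!mulmxA Fa Fb !mulmxDr !mulmxN -!scalemxAr.
  by rewrite IHa IHb !scaler0 subr0 addr0.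
by split; apply: (observable_inj AQ_observable) => i; have [] := h i.
Qed.

(** A vector fixed by A and killed by Qhalf is unobservable, hence 0. The left inverse later
    recovers the stationary mean from quantities that the cost controls. *)
Lemma mean_linv : exists (N1 : 'M[R]_n) (N2 : 'M[R]_n),
  N1 *m (1%:M - A) + N2 *m Qhalf = 1%:M.
Proof.
have [N hN] : exists N : 'M[R]_(n, n + n), N *m col_mx (1%:M - A) Qhalf = 1%:M.
  apply: ker0_linv => x; rewrite mul_col_mx => /eqP; rewrite col_mx_eq0.
  move=> /andP[/eqP]; rewrite mulmxBl mul1mx => /eqP;
    rewrite subr_eq0 => /eqP xA /eqP Qx.
  apply: (observable_inj AQ_observable) => i.
  have -> : A ^+ i *m x = x; last exact: Qx.
  by elim: i => [|i IH]; rewrite ?expr0 ?mul1mx// exprSr -mulmxA -xA.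
exists (lsubmx N), (rsubmx N).
by rewrite -mul_row_col hsubmxK.
Qed.

(* Triples (X, P, x): any such P and x are the value matrix and the stationary
   mean of X, and the existence of P forces X to be stabilizing. *)
Definition certificates : set ('M[R]_(m, n + 1) * ('M[R]_n * 'cV[R]_n)) :=
  [set z | [/\ z.2.1^T = z.2.1, forall v, 0 <= qform z.2.1 v,
     z.2.1 = gcost z.1 + (F z.1)^T *m z.2.1 *m F z.1,
     z.2.2 = F z.1 *m z.2.2 + B *m offset z.1 + wbar
   & \tr (W *m z.2.1) + mean_cost z.1 z.2.2 <= alpha]].

(** Stability is an open condition; on the triples it is replaced by closed equations and
    inequalities, and compactness then passes through the projection. *)
Lemma certificates_sublevel :
  [set X | stable X /\ \tr (acost X *m Phi X) <= alpha] = fst @` certificates.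
Proof.
apply/seteqP; split=> [X [sX Xa]|_ [[X [P x]] [/= sP P0 PE xE ha] <-]].
  have F0 := stable_power sX; have Ft := power_cvg0_tr F0.
  have [sP P0] : psd (value_mx X) := stein_psd F0 (gain_cost_psd Qm_psd
    Ru_posdef X).
  exists (X, (value_mx X, xbar X)) => //; split=> //=.
  - exact: stein_eq.
  - exact: stat_mean_eq.
  - by rewrite -total_costE.
have sX : stable X by exact: observable_stable PE.
have F0 := stable_power sX; have Ft := power_cvg0_tr F0.
split=> //; rewrite total_costE//.
have <- : P = value_mx X by apply/(steinP _ _ Ft F0).
have <- // : x = xbar X.
rewrite stat_meanE//; apply: (canRL (mulKmx (power_cvg0_sub1_unit F0))).
by rewrite mulmxBl mul1mx; apply/eqP; rewrite subr_eq addrC addrA -xE.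
Qed.

Lemma cost_bounds z : certificates z ->
  let b := alpha + (qform Q v0 + c) in
  [/\ \tr (W *m z.2.1) <= b, qform Q (z.2.2 + v0) <= b &
      qform Ru (control z.1 z.2.2) <= b].
Proof.
move=> [sP P0 _ _ ha] b; have := mean_cost_ge z.1 z.2.2.
have h1 := mxtrace_psd_mul_ge0 (posdef_psd W_posdef) (conj sP P0).
have h2 := Q_psd.2 (z.2.2 + v0);
  have h3 := (posdef_psd Ru_posdef).2 (control z.1 z.2.2).
by rewrite /b; split; lra.
Qed.

(** A chain of bounds: W > 0 bounds the trace of P, P >= K^T Ru K bounds the gain, Ru bounds the
    control at the mean, the left inverse bounds the mean, and the offset is control plus K times
    mean. *)
Lemma certificates_bounded :
  [/\ bounded_on certificates (fun z => z.1),
    bounded_on certificates (fun z => z.2.1)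
    & bounded_on certificates (fun z => z.2.2)].
Proof.
pose b := alpha + (qform Q v0 + c).
have lW : 0 < lambda_min W := lambda_min_gt0 n_gt0 W_posdef.
have lR : 0 < lambda_min Ru := lambda_min_gt0 m_gt0 Ru_posdef.
have trP z : certificates z -> \tr z.2.1 <= b / lambda_min W.
  move=> Cz; have [h _ _] := cost_bounds Cz; have [sP P0 _ _ _] := Cz.
  rewrite ler_pdivlMr//; apply: le_trans h.
  have : 0 <= \tr ((W - (lambda_min W)%:M) *m z.2.1).
    apply: mxtrace_psd_mul_ge0 (conj sP P0); split.
      by rewrite linearB /= W_posdef.1 tr_scalar_mx.
    move=> v; rewrite qform_addmx qform_oppmx -scalemx1 qform_scalemx qform1
      subr_ge0.
    exact: lambda_min_le n_gt0 W_posdef.1.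
  have trB (M1 M2 : 'M[R]_n) :
    \tr (M1 - M2) = \tr M1 - \tr M2 by rewrite linearB.
  by rewrite mulmxBl trB mul_scalar_mx mxtraceZ subr_ge0 mulrC.
have bP : bounded_on certificates (fun z => z.2.1).
  exists (b / lambda_min W) => z Cz i j.
  by apply: le_trans (trP _ Cz); apply: psd_entry_le; have [] := Cz.
have bK : bounded_on certificates (fun z => gain z.1).
  exists (1 + b / lambda_min W / lambda_min Ru) => z Cz i j.
  have [sP P0 PE _ _] := Cz.
  pose e : 'cV[R]_n := delta_mx j 0.
  have Pe : qform z.2.1 e <= b / lambda_min W.
    apply: le_trans (trP _ Cz); apply: le_trans (_ : z.2.1 j j <= _).
      by rewrite /qform /inner trmx_delta -colE -rowE !mxE.
    rewrite /mxtrace (bigD1 j)//= lerDl sumr_ge0// => k _.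
    have := P0 (delta_mx k 0).
    by rewrite /qform /inner trmx_delta -colE -rowE !mxE.
  have Ke : lambda_min Ru * inner (gain z.1 *m e) (gain z.1 *m e) <= qform
    z.2.1 e.
    apply: le_trans (lambda_min_le _ m_gt0 Ru_posdef.1) _.
    rewrite {1}PE qform_addmx qform_congr /gain_cost qform_addmx qform_congr.
    by have := Qm_psd.2 e; have := P0 (F z.1 *m e); lra.
  have Kij : gain z.1 i j ^+ 2 <= b / lambda_min W / lambda_min Ru.
    rewrite ler_pdivlMr// mulrC; apply: le_trans Pe; apply: le_trans Ke.
    rewrite ler_pM2l//; apply: le_trans (inner_coord_le _ i).
    by rewrite /e -colE [col _ _ _ _]mxE.
  set g := gain _ _ _ in Kij *.
  rewrite ler_norml; apply/andP; split.
    by have := sqr_ge0 (g + 1); rewrite sqrrD expr1n; nra.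
  by have := sqr_ge0 (g - 1); rewrite sqrrB expr1n; nra.
have bu : bounded_on certificates (fun z => control z.1 z.2.2).
  apply: (@bounded_on_inner _ _ _ _ _ (b / lambda_min Ru)) => z Cz.
  have [_ _ h] := cost_bounds Cz; rewrite ler_pdivlMr// mulrC.
  by apply: le_trans h; exact: lambda_min_le m_gt0 Ru_posdef.1.
have bQ : bounded_on certificates (fun z => Qhalf *m (z.2.2 + v0)).
  apply: (@bounded_on_inner _ _ _ _ _ b) => z Cz.
  by rewrite -qform_Q; have [] := cost_bounds Cz.
have [N1 [N2 N12]] := mean_linv.
(* The stationary equation reads (1 - A) x = B u + wbar, so the gain does not appear once u is known
   to be bounded. *)
have xE z : certificates z -> z.2.2 = (N1 *m (B *m control z.1 z.2.2 + wbar)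
    + N2 *m (Qhalf *m (z.2.2 + v0))) + - (N2 *m (Qhalf *m v0)).
  move=> [_ _ _ xE _].
  have -> : B *m control z.1 z.2.2 + wbar = (1%:M - A) *m z.2.2.
    rewrite mulmxBl mul1mx /control mulmxDr mulmxN.
    apply/eqP; rewrite eq_sym subr_eq eq_sym {3}xE /closed_loop mulmxBl
      -!mulmxA.
    move: (A *m _) (B *m (gain _ *m _)) (B *m offset _) => a1 a2 a3.
    by apply/eqP/colP => i; rewrite !mxE; ring.
  rewrite [Qhalf *m (_ + _)]mulmxDr [N2 *m (_ + _)]mulmxDr addrA addrK !mulmxA
    -mulmxDl N12.
  by rewrite mul1mx.
have bx : bounded_on certificates (fun z => z.2.2).
  have [bb h] : bounded_on certificates (fun z =>
     (N1 *m (B *m control z.1 z.2.2 + wbar)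
    + N2 *m (Qhalf *m (z.2.2 + v0))) + - (N2 *m (Qhalf *m v0))).
    apply: bounded_onD; last exact: bounded_on_cst.
    apply: bounded_onD; apply: bounded_on_mulmx; try exact: bounded_on_cst.
      apply: bounded_onD; last exact: bounded_on_cst.
      by apply: bounded_on_mulmx => //; exact: bounded_on_cst.
    exact: bQ.
  by exists bb => z Cz i j; rewrite (xE _ Cz); exact: h.
split=> //.
have [bb h] : bounded_on certificates (fun z =>
    row_mx (gain z.1) (control z.1 z.2.2 + gain z.1 *m z.2.2)).
  apply: bounded_on_row_mx => //; apply: bounded_onD => //.
  exact: bounded_on_mulmx.
exists bb => z Cz i j; have := h z Cz i j.
by rewrite /control addrC addrA addrN add0r -policyE.
Qed.

Lemma certificates_closed : closed certificates.
Proof.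
pose V := ('M[R]_(m, n + 1) * ('M[R]_n * 'cV[R]_n))%type.
have cX : continuous (fun z : V => z.1) by move=> z; exact: cvg_fst.
have c2 : continuous (fun z : V => z.2) by move=> z; exact: cvg_snd.
have cP : continuous (fun z : V => z.2.1).
  by move=> z; apply: (cvg_comp _ _ (c2 z)); exact: cvg_fst.
have cx : continuous (fun z : V => z.2.2).
  by move=> z; apply: (cvg_comp _ _ (c2 z)); exact: cvg_snd.
have cM p q (M : 'M[R]_(p, q)) : continuous (fun _ : V => M) by move=> z;
  exact: cvg_cst.
have cK (z : V) := cvg_gain (cX z); have cl (z : V) := cvg_offset (cX z).
have cF (z : V) : (fun t : V => F t.1) @ z --> F z.1 by exact: cvg_closed_loop
  (cX z).
have cu : continuous (fun z : V => control z.1 z.2.2).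
  move=> z; apply: cvgD; last exact: cl.
  by apply: cvgN; exact: (cvg_mulmx (cK z) (cx z)).
have cq p (M : 'M[R]_p) (g : V -> 'cV[R]_p) : continuous g ->
    continuous (fun z => qform M (g z)).
  by move=> cg z; apply: cvg_qform; exact: cg.
rewrite (_ : certificates =
  [set z : V | z.2.1^T = z.2.1] `&`
  (\bigcap_(v in [set: 'cV[R]_n]) [set z : V | 0 <= qform z.2.1 v]) `&`
  [set z : V | z.2.1 = gcost z.1 + (F z.1)^T *m z.2.1 *m F z.1] `&`
  [set z : V | z.2.2 = F z.1 *m z.2.2 + B *m offset z.1 + wbar] `&`
  [set z : V | \tr (W *m z.2.1) + mean_cost z.1 z.2.2 <= alpha]); last first.
  apply/seteqP; split=> [z [h1 h2 h3 h4 h5]|z [[[[h1 h2] h3] h4] h5]].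
    by do 4?split => //; move=> v _; exact: h2.
  by split=> //; move=> v; exact: h2.
do 4?[apply: closedI].
- by apply: closed_eq_cts => // z; exact: cvg_trmx (cP z).
- apply: closed_bigI => v _; apply: closed_le_cts => z; first exact: cvg_cst.
  have cc : (fun z : V => v^T *m (z.2.1 *m v)) @ z --> v^T *m (z.2.1 *m v).
    exact: (cvg_mulmx (cM _ _ _ z) (cvg_mulmx (cP z) (cM _ _ _ z))).
  exact: ((cvg_mxP _ _).1 cc 0 0).
- apply: closed_eq_cts => // z; apply: cvgD.
    apply: cvgD; first exact: cM.
    exact: (cvg_mulmx (cvg_mulmx (cvg_trmx (cK z)) (cM _ _ _ z)) (cK z)).
  exact: (cvg_mulmx (cvg_mulmx (cvg_trmx (cF z)) (cP z)) (cF z)).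
- apply: closed_eq_cts => // z; apply: cvgD; last exact: cM.
  exact: cvgD (cvg_mulmx (cF z) (cx z)) (cvg_mulmx (cM _ _ _ z) (cl z)).
- apply: closed_le_cts => z; last exact: cvg_cst.
  apply: cvgD; first exact: (cvg_mxtrace (cvg_mulmx (cM _ _ _ z) (cP z))).
  apply: cvgB; last exact: cvg_cst.
  apply: cvgD; last exact: cq.
  apply: cvgD; first exact: cq.
  apply: cvgM; first exact: cvg_cst.
  have cc : (fun z : V => z.2.2^T *m S) @ z --> z.2.2^T *m S.
    exact: (cvg_mulmx (cvg_trmx (cx z)) (cM _ _ _ z)).
  exact: ((cvg_mxP _ _).1 cc 0 0).
Qed.

Lemma sublevel_compact :
  compact [set X | stable X /\ \tr (acost X *m Phi X) <= alpha].
Proof.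
rewrite certificates_sublevel; apply: continuous_compact.
  by apply: continuous_subspaceT => z; exact: cvg_fst.
have [[b1 h1] [b2 h2] [b3 h3]] := certificates_bounded.
apply: (subclosed_compact certificates_closed
  (compact_setX (@compact_mx_box R m (n + 1) b1)
    (compact_setX (@compact_mx_box R n n b2) (@compact_mx_box R n 1 b3)))).
by move=> z Cz; split; [exact: h1|split; [exact: h2|exact: h3]].
Qed.

End sublevel_sets.

(** * Gradient domination *)

Section trace_bounds.
Context {R : realType}.

Lemma mxtrace_gram_le n p (M : 'M[R]_n) (E : 'M[R]_(p, n)) :
  \tr (M *m (E^T *m E)) <= spectral_norm M * \tr (E *m E^T).
Proof.
rewrite mulmxA mxtrace_mulC mulmxA mxtrace_gram.
have -> : \tr (E *m E^T) = \sum_i inner (row i E)^T (row i E)^T.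
  by rewrite -{1}[E]mulmx1 mxtrace_gram; apply: eq_bigr => i _; rewrite qform1.
rewrite mulr_sumr; apply: ler_sum => i _; set v := (row i E)^T.
apply: le_trans (inner_le_norm2 _ _) _.
rewrite -norm2_sqr expr2 mulrA [leRHS]mulrC.
by apply: ler_wpM2l; [exact: norm2_ge0|exact: norm2_mulmx_le].
Qed.

(** Row by row this is |M v| >= s |v|, which follows from s |v|^2 <= <v, M v> <= |v| |M v| without
    diagonalising M. *)
Lemma mxtrace_mulmx_ge n p (M : 'M[R]_n) (E : 'M[R]_(p, n)) s :
  (0 < n)%N -> posdef M -> 0 <= s <= lambda_min M ->
  s ^+ 2 * \tr (E *m E^T) <= \tr ((E *m M)^T *m (E *m M)).
Proof.
move=> n0 Mpos /andP[s0 sM]; have [symM _] := Mpos.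
have -> : \tr ((E *m M)^T *m (E *m M)) = \tr (E *m (M *m M) *m E^T).
  by rewrite mxtrace_mulC trmx_mul symM !mulmxA.
rewrite [leRHS]mxtrace_gram.
have -> : \tr (E *m E^T) = \sum_i inner (row i E)^T (row i E)^T.
  by rewrite -{1}[E]mulmx1 mxtrace_gram; apply: eq_bigr => i _; rewrite qform1.
rewrite mulr_sumr; apply: ler_sum => i _; set v := (row i E)^T.
have -> : qform (M *m M) v = inner (M *m v) (M *m v).
  by rewrite /qform -mulmxA inner_mulmx symM.
have [->|v0] := eqVneq v 0; first by rewrite mulmx0 !inner0r mulr0.
have nv : 0 < inner v v by rewrite inner_gt0.
have h : s * inner v v <= qform M v.
  by apply: le_trans (lambda_min_le v n0 symM); rewrite ler_pM2r.
have := cauchy_schwarz v (M *m v); rewrite -/(qform M v) => cs.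
have h2 : (s * inner v v) ^+ 2 <= qform M v ^+ 2.
  by rewrite ler_sqr ?nnegrE ?mulr_ge0// ?(ltW nv)//; apply: le_trans h;
    rewrite mulr_ge0// ltW.
rewrite -(ler_pM2l nv); apply: le_trans cs; apply: le_trans h2.
by rewrite exprMn (expr2 (inner v v)) mulrCA.
Qed.

(** M is first lowered to the scalar matrix s, which commutes with everything; the remaining
    quadratic is minimized over D at - E / s, so the bound no longer involves D. *)
Lemma square_completion n m (Phi : 'M[R]_n) (Ru M : 'M[R]_m) (E D : 'M[R]_(m,
    n)) s :
  0 < s -> psd Phi -> psd (M - Ru) -> psd (Ru - s%:M) ->
  - (s^-1 * \tr (Phi *m (E^T *m E)))
    <= 2 * \tr (Phi *m (D^T *m E)) + \tr (Phi *m (D^T *m M *m D)).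
Proof.
move=> s0 Phi0 M0 R0.
have MS : psd (M - s%:M) by rewrite -(subrK Ru M) -addrA; exact: psdD.
have h1 : s * \tr (Phi *m (D^T *m D)) <= \tr (Phi *m (D^T *m M *m D)).
  have := mxtrace_congr_ge0 D Phi0 MS.
  have trB (N1 N2 : 'M[R]_n) :
    \tr (N1 - N2) = \tr N1 - \tr N2 by rewrite linearB.
  rewrite mulmxBr mulmxBl mulmxBr trB subr_ge0 mul_mx_scalar -scalemxAl.
  by rewrite -scalemxAr mxtraceZ.
pose Y := D + s^-1 *: E.
have h2 : 0 <= \tr (Phi *m (Y^T *m Y)) by apply: mxtrace_psd_mul_ge0 => //;
  exact: psd_gram.
have cross : \tr (Phi *m (E^T *m D)) = \tr (Phi *m (D^T *m E)).
  by rewrite -mxtrace_tr !trmx_mul trmxK Phi0.1 mxtrace_mulC.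
have YE : \tr (Phi *m (Y^T *m Y)) = \tr (Phi *m (D^T *m D))
    + 2 * s^-1 * \tr (Phi *m (D^T *m E)) + s^-1 ^+ 2 * \tr (Phi *m (E^T *m E)).
  have YT : Y^T = D^T + s^-1 *: E^T by apply/matrixP => i j; rewrite !mxE.
  rewrite YT /Y mulmxDl !mulmxDr -!scalemxAl -!scalemxAr.
  rewrite !mxtraceD !mxtraceZ cross; ring.
have : 0 <= s * \tr (Phi *m (Y^T *m Y)) by rewrite mulr_ge0// ltW.
rewrite YE; set a := \tr _ in h1 *; set b := \tr _; set e := \tr _.
have -> : s * (a + 2 * s^-1 * b + s^-1 ^+ 2 * e) = s * a + 2 * b + s^-1 * e.
  by field; rewrite gt_eqF.
move: h1; rewrite -/a; set f := \tr _; lra.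
Qed.

Lemma spectral_norm_gt0 n (M : 'M[R]_n) :
    (0 < n)%N -> posdef M -> 0 < spectral_norm M.
Proof.
move=> n0 Mpos; have [v v1] := sphere_nonempty (R := R) n0.
have v0 : v != 0 by rewrite -inner_eq0 v1 oner_neq0.
have := Mpos.2 v v0; rewrite /qform => h.
have nv : norm2 v = 1 by rewrite /norm2 v1 sqrtr1.
apply: lt_le_trans h _; apply: le_trans (inner_le_norm2 _ _) _.
rewrite nv mul1r; apply: le_trans (norm2_mulmx_le _ _) _.
by rewrite nv mulr1.
Qed.

(** The scalar bookkeeping: p = ||Phi*||, r and s are sigma(R) and sigma_alpha, t = tr (E E^T), e =
    tr (Phi* E^T E), a and b are the costs of X* and X, and 4 g is the squared norm of the
    gradient. *)
Lemma dominated_gap (p r s t g e a b : R) :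
    - (r^-1 * e) <= a - b -> e <= p * t ->
  s ^+ 2 * t <= g -> 0 < p -> 0 < r -> 0 < s ->
  b - a <= p / (4 * r * s ^+ 2) * (4 * g).
Proof.
move=> ab ep tg p0 r0 s0; apply: (@le_trans _ _ (r^-1 * e)); first by lra.
apply: (@le_trans _ _ (r^-1 * (p * t))); first by rewrite ler_pM2l ?invr_gt0.
have -> : p / (4 * r * s ^+ 2) * (4 * g) = r^-1 * (p * (g / s ^+ 2)).
  by field; rewrite !gt_eqF.
rewrite ler_pM2l ?invr_gt0// ler_pM2l//.
by rewrite ler_pdivlMr ?exprn_gt0// mulrC.
Qed.

End trace_bounds.

Section gradient_domination.
Context {R : realType} {n m : nat}.
Variables (n_gt0 : (0 < n)%N) (m_gt0 : (0 < m)%N).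
Variables (A : 'M[R]_n) (B : 'M[R]_(n, m)) (wbar : 'cV[R]_n) (W : 'M[R]_n).
Variables (Q Q2 Qhalf : 'M[R]_n) (v0 : 'cV[R]_n) (Ru : 'M[R]_m) (c alpha : R).
Hypotheses (W_posdef : posdef W) (Q2_psd : psd Q2) (Ru_posdef : posdef Ru).
Hypotheses (Qhalf_sqrt : psd_sqrt Qhalf Q) (AQ_observable : observable A Qhalf).
Variable L : 'M[R]_(m, n + 1) -> R.
Local Notation stable X := (spectral_radius (closed_loop A B X) < 1).
Local Notation Phi := (Phi_mx A B wbar W).
Local Notation acost X := (aug_cost (Q + Q2) (Q *m v0) Ru c X).
Hypothesis LE : forall X, stable X -> L X = \tr (acost X *m Phi X).
Local Notation Salpha := [set X | stable X /\ L X <= alpha].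

Lemma L_difference X : stable X -> exists (E : 'M[R]_(m, n + 1)) (M : 'M[R]_m),
  psd (M - Ru) /\ forall Y, stable Y -> L Y - L X =
     2 * \tr (Phi Y *m ((Y - X)^T *m E)) + \tr (Phi Y *m ((Y - X)^T *m M *m (Y
       - X))).
Proof.
move=> sX; have Qmpsd := Qm_psd Q2_psd Qhalf_sqrt.
have [E [M [M0 h]]] := cost_difference wbar (Q *m v0) c W_posdef Qmpsd
  Ru_posdef sX.
by exists E, M; split=> // Y sY; rewrite !LE// h.
Qed.

Lemma Salpha_compact : compact Salpha.
Proof.
rewrite (_ : mkset _ = [set X | stable X /\ \tr (acost X *m Phi X) <= alpha]).
  exact: (sublevel_compact n_gt0 m_gt0 W_posdef Q2_psd Ru_posdef Qhalf_sqrt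
    AQ_observable).
by apply/seteqP; split=> X /= [sX h]; split=> //; rewrite ?LE// -LE.
Qed.

Lemma L_continuous X : stable X -> {for X, continuous L}.
Proof.
move=> sX; rewrite /prop_for /continuous_at LE//.
have cX : (fun Y : 'M[R]_(m, n + 1) => Y) @ X --> X by exact: cvg_id.
have h : (fun Y => \tr (acost Y *m Phi Y)) @ X --> \tr (acost X *m Phi X).
  have c0 p q (M : 'M[R]_(p, q)) : continuous (fun _ : 'M[R]_(m, n + 1) => M).
    exact: cst_continuous.
  have h1 : (fun Y => acost Y) @ X --> acost X.
    exact: (cvgD (c0 _ _ _ X) (cvg_mulmx (cvg_mulmx (cvg_trmx cX) (c0 _ _ Ru
      X)) cX)).
  have h2 : (fun Y => Phi Y) @ X --> Phi X by exact: (cvg_Phi cX sX).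
  exact: (cvg_mxtrace (cvg_mulmx h1 h2)).
have FX : Filter (nbhs X) by exact: nbhs_filter.
have e : \forall Y \near nbhs X, \tr (acost Y *m Phi Y) = L Y.
  by apply: filterS (near_stable cX sX) => Y sY; rewrite LE.
by apply: cvg_trans h; exact: (near_eq_cvg e).
Qed.

(** Global optimality without convexity: Phi X > 0 turns a zero gradient into E = 0, and only the
    nonnegative quadratic term of the cost identity remains. *)
Lemma critical_minimizer X : stable X -> gradient L X = 0 ->
  forall Y, stable Y -> L X <= L Y.
Proof.
move=> sX gX Y sY; have [E [M [M0 h]]] := L_difference sX.
have gE := gradientE sX h; rewrite gX in gE.
have EP : E *m Phi X = 0.
  by apply/eqP; move/esym/eqP: gE; rewrite scaler_eq0 pnatr_eq0.
have E0 := mulmx_Phi_eq0 W_posdef sX EP.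
rewrite -subr_ge0 h// E0 !mulmx0 mxtrace0 mulr0 add0r.
apply: mxtrace_congr_ge0; first exact/posdef_psd/Phi_posdef.
by rewrite -(subrK Ru M); apply: psdD => //; exact: posdef_psd.
Qed.

Lemma critical_exists : Salpha !=set0 ->
  exists X, stable X /\ gradient L X = 0.
Proof.
move=> ne; have [|X] := compact_EVT_min ne Salpha_compact (f := L).
  by apply: continuous_in_subspaceT => X /set_mem[sX _]; exact: L_continuous.
move=> /set_mem[sX Xa] minX.
have [E [M [M0 h]]] := L_difference sX.
exists X; split=> //; rewrite (gradientE sX h) (minimizer_critical sX h)
  ?scaler0//.
(* A minimizer over the sublevel set is global, since outside it the cost exceeds alpha. *)
move=> Y sY; have [Ya|Ya] := leP (L Y) alpha.
  by apply: minX; exact: mem_set.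
by apply: le_trans Xa _; exact: ltW.
Qed.

(** The form is minimized jointly over the sublevel set and the unit sphere, so that continuity of
    [lambda_min] itself is not called for. *)
Lemma lambda_min_Phi_attained : Salpha !=set0 ->
  exists2 X, Salpha X & forall Y, Salpha Y ->
    lambda_min (Phi X) <= lambda_min (Phi Y).
Proof.
move=> ne; have n1 : (0 < n + 1)%N by rewrite addn1.
pose sphere := [set v : 'cV[R]_(n + 1) | inner v v = 1].
pose f (z : 'M[R]_(m, n + 1) * 'cV[R]_(n + 1)) := qform (Phi z.1) z.2.
have ne2 : Salpha `*` sphere !=set0.
  by have [X Xa] := ne; have [v vs] := sphere_nonempty (R := R) n1;
    exists (X, v).
have [|[X v]] := compact_EVT_min ne2 (compact_setX Salpha_compact
  (@sphere_compact R (n + 1))) (f := f).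
  apply: continuous_in_subspaceT => -[X v] /set_mem [[/= sX _] _].
  have FXv : Filter (nbhs (X, v)) by exact: nbhs_filter.
  have c1 : (fun z : 'M[R]_(m, n + 1) * 'cV[R]_(n + 1) => z.1) @ (X,
    v) --> X by exact: cvg_fst.
  have c2 : (fun z : 'M[R]_(m, n + 1) * 'cV[R]_(n + 1) => z.2) @ (X,
    v) --> v by exact: cvg_snd.
  have c3 : (fun z : 'M[R]_(m, n + 1) * 'cV[R]_(n + 1) => Phi z.1) @ (X,
    v) --> Phi X.
    exact: cvg_Phi c1 sX.
  have c4 := cvg_mulmx (cvg_trmx c2) (cvg_mulmx c3 c2).
  have {}c4 := c4 FXv FXv FXv.
  exact: ((@cvg_mxP _ _ _ FXv _ _ _ _).1 c4 0 0).
move=> Xv minXv; have {Xv}[Xa v1] : (Salpha `*` sphere) (X,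
  v) by exact: set_mem.
have {}Xa : Salpha X := Xa; have {}v1 : inner v v = 1 := v1.
exists X; first exact: Xa.
move=> Y Ya; have [sX _] := Xa; have [sY _] := Ya.
have [u u1 uE] := lambda_min_eigenvector n1 (Phi_sym wbar W_posdef sY).
rewrite -uE; have fle : f (X, v) <= f (Y, u) by apply: minXv; apply: mem_set;
  split.
apply: le_trans fle.
by have := lambda_min_le v n1 (Phi_sym wbar W_posdef sX); rewrite v1 mulr1.
Qed.

Lemma gradient_domination :
  let Lstar := minimum [set L X | X in [set X | stable X]] in
  let Xstar := get [set X | stable X /\ gradient L X = 0] in
  let sigmas := [set lambda_min (Phi X) | X in Salpha] in
  let lambda_alpha :=
    spectral_norm (Phi Xstar) / (4 * lambda_min Ru * minimum sigmas ^+ 2) in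
  (forall X, Salpha X ->
     L X - Lstar <= lambda_alpha * \tr ((gradient L X)^T *m gradient L X)) /\
  (Salpha !=set0 ->
     [/\ is_minimum sigmas (minimum sigmas),
       0 < minimum sigmas & 0 < lambda_alpha]).
Proof.
move=> Lstar Xstar sigmas lambda_alpha.
(* Any X in the inequality witnesses nonemptiness, which is what gives [Xstar] and the minima their
   meaning. *)
suff main : Salpha !=set0 ->
    (forall X, Salpha X ->
     L X - Lstar <= lambda_alpha * \tr ((gradient L X)^T *m gradient L X)) /\
     [/\ is_minimum sigmas (minimum sigmas),
       0 < minimum sigmas & 0 < lambda_alpha].
  split=> [X Xa|/main[]//].
  by have [|h _] := main; [exists X|exact: h].
move=> ne; have n1 : (0 < n + 1)%N by rewrite addn1.
have [X1 X1a minX1] := lambda_min_Phi_attained ne.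
have sig_min : is_minimum sigmas (lambda_min (Phi X1)).
  by split; [exists X1|move=> _ [Y Ya <-]; exact: minX1].
have sigE : minimum sigmas = lambda_min (Phi X1) := minimumP sig_min.
have sig0 : 0 < lambda_min (Phi X1).
  by apply: lambda_min_gt0 => //; apply: Phi_posdef => //; case: X1a.
have [sXs gXs] : stable Xstar /\ gradient L Xstar = 0.
  by apply: (getPex (critical_exists ne)).
have Xs_min := critical_minimizer sXs gXs.
have LstarE : Lstar = L Xstar.
  by apply: minimumP; split; [exists Xstar|move=> _ [Y sY <-]; exact: Xs_min].
have lR : 0 < lambda_min Ru := lambda_min_gt0 m_gt0 Ru_posdef.
have Phis_pos := Phi_posdef wbar W_posdef sXs.
have nPhi := spectral_norm_gt0 n1 Phis_pos.
have lamE : lambda_alpha = spectral_norm (Phi Xstar)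
    / (4 * lambda_min Ru * lambda_min (Phi X1) ^+ 2) by rewrite /lambda_alpha
      sigE.
have lam0 : 0 < lambda_alpha.
  rewrite lamE divr_gt0// mulr_gt0 ?mulr_gt0 ?exprn_gt0//.
split; last by rewrite sigE.
move=> X [sX Xa]; have [E [M [M0 h]]] := L_difference sX.
rewrite (gradientE sX h) LstarE.
have R0 : psd (Ru - (lambda_min Ru)%:M).
  split; first by rewrite linearB /= Ru_posdef.1 tr_scalar_mx.
  move=> v; rewrite qform_addmx qform_oppmx -scalemx1 qform_scalemx qform1
    subr_ge0.
  exact: lambda_min_le m_gt0 Ru_posdef.1.
(* The identity is based at X and evaluated at [Xstar]: the weight is then Phi Xstar while E is the
   factor of the gradient at X. *)
have := square_completion E (Xstar - X) lR (posdef_psd Phis_pos) M0 R0.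
rewrite -h// => h1.
have h2 := mxtrace_gram_le (Phi Xstar) E.
have h3 : lambda_min (Phi X1) ^+ 2 * \tr (E *m E^T) <= \tr ((E *m Phi X)^T *m
  (E *m Phi X)).
  apply: (mxtrace_mulmx_ge _ n1 (Phi_posdef wbar W_posdef sX)).
  by apply/andP; split; [exact: ltW|apply: minX1; split].
have -> : \tr ((2 *: (E *m Phi X))^T *m (2 *: (E *m Phi X)))
    = 4 * \tr ((E *m Phi X)^T *m (E *m Phi X)).
  have trZ (N : 'M[R]_(m, n + 1)) : (2 *: N)^T = 2 *: N^T by rewrite linearZ.
  by rewrite trZ -scalemxAl -scalemxAr !mxtraceZ; ring.
rewrite lamE; exact: (dominated_gap h1 h2 h3 nPhi lR sig0).
Qed.

End gradient_domination.

Theorem lemma6 (R : realType) (n m : nat) (n_gt0 : (0 < n)%N) (m_gt0 : (0 < m)%N)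
    (d : measure_display) (T : measurableType d) (P : probability T R)
    (A : 'M[R]_n) (B : 'M[R]_(n, m))
    (Q Qhalf : 'M[R]_n) (Ru : 'M[R]_m) (rhobar : R)
    (w : nat -> T -> 'cV[R]_n) (x0 : T -> 'cV[R]_n)
    (w_iid : iid P w)
    (w_moment4 : forall t, finite_moment P 4 (w t))
    (W_posdef : posdef (noise_cov P w))
    (x0_random : random_vector x0)
    (x0_moment2 : finite_moment P 2 x0)
    (Q_psd : psd Q) (Ru_posdef : posdef Ru)
    (Qhalf_sqrt : psd_sqrt Qhalf Q)
    (AB_controllable : controllable A B)
    (AQ_observable : observable A Qhalf)
    (mu : R) (mu_gt0 : 0 < mu) (alpha : R) :
  let S : set 'M[R]_(m, n + 1) := stabilizing A B in
  let L : 'M[R]_(m, n + 1) -> R := lagrangian A B P w x0 Q Ru rhobar mu in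
  let Lstar : R := minimum [set L X | X in S] in
  let Salpha : set 'M[R]_(m, n + 1) := [set X | S X /\ L X <= alpha] in
  let Phi : 'M[R]_(m, n + 1) -> 'M[R]_(n + 1) :=
    Phi_mx A B (noise_mean P w) (noise_cov P w) in
  let Xstar : 'M[R]_(m, n + 1) := get [set X | S X /\ gradient L X = 0] in
  let sigmas : set R := [set lambda_min (Phi X) | X in Salpha] in
  let sigma_alpha : R := minimum sigmas in
  let lambda_alpha : R :=
    spectral_norm (Phi Xstar) / (4 * lambda_min Ru * sigma_alpha ^+ 2) in
  (forall X, Salpha X ->
     L X - Lstar <= lambda_alpha * \tr ((gradient L X)^T *m gradient L X)) /\
  (Salpha !=set0 ->
     [/\ is_minimum sigmas sigma_alpha, 0 < sigma_alpha & 0 < lambda_alpha]).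
Proof.
move=> S L Lstar Salpha Phi Xstar sigmas sigma_alpha lambda_alpha.
have [w_random _ _] := w_iid.
have w_L2 t : L2v P (w t) by apply: (@finite_moment_L2v _ _ _ _ _ 2).
have x0_L2 : L2v P x0 by apply: (@finite_moment_L2v _ _ _ _ _ 1).
pose Q2 := (4 * mu) *: (Q *m noise_cov P w *m Q).
have Q2_psd : psd Q2.
  apply: psdZ; first by rewrite mulr_ge0// ltW.
  by rewrite -{1}Q_psd.1; apply/psd_congr/posdef_psd.
(* The factor Q in S = 2 mu Q M3 is pulled out to exhibit S in the range of Q. *)
pose v0 := (2 * mu) *: noise_M3 P w Q.
have SE : Smu P w Q mu = Q *m v0 by rewrite /Smu /v0 scalemxAr.
have LE X : spectral_radius (closed_loop A B X) < 1 ->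
    L X = \tr (aug_cost (Q + Q2) (Q *m v0) Ru (mu * rhobar) X *m Phi X).
  move=> sX; apply: (cvg_time_average w_iid w_L2 x0_L2 (stable_power_cvg0 sX)
    (f := fun x => stage_cost P w Q Ru rhobar mu x (control X x))) => x.
  by rewrite qform_aug_cost /mean_cost /stage_cost SE.
exact: (gradient_domination n_gt0 m_gt0 alpha W_posdef Q2_psd Ru_posdef
  Qhalf_sqrt AQ_observable LE).
Qed.
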